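(* There exists a unique multiplication $*$ on the free $\widetilde R$-module ${}^{BL}\widetilde{\mathcal H}_{\widetilde R}$ which makes it an associative unitary $\widetilde R$-algebra with unity $H_1=T_1=Z^0$, for which $T_\omega*(Z^\lambda H_w)=T_\omega Z^\lambda H_w$, and which satisfies the following conditions: (1) for all $\lambda\in Y$, $w\in W^v$: $Z^\lambda*H_w=Z^\lambda H_w$; (2) for all $i\in I$, $w\in W^v$: $H_i*H_w=H_{r_iw}$ if $\ell(r_iw)>\ell(w)$, and $H_i*H_w=(\widetilde\sigma_i-\widetilde\sigma_i^{-1})H_w+H_{r_iw}$ if $\ell(r_iw)<\ell(w)$; (3) for all $\lambda,\mu\in Y$: $Z^\lambda*Z^\mu=Z^{\lambda+\mu}$; (4) for all $\lambda\in Y$, $i\in I$: $H_i*Z^\lambda-Z^{r_i(\lambda)}*H_i=b(\widetilde\sigma_i,\widetilde\sigma_i';Z^{-\alpha_i^\vee})(Z^\lambda-Z^{r_i(\lambda)})$, where $b(t,u;z)=\dfrac{(t-t^{-1})+(u-u^{-1})z}{1-z^2}$; (5) for all $\omega,\omega'\in\Omega$, $i\in I$, $\lambda\in Y$: $T_\omega*T_{\omega'}=T_{\omega\omega'}$, $T_\omega*H_i*T_\omega^{-1}=H_{\omega(i)}$, $T_\omega*Z^\lambda*T_\omega^{-1}=Z^{\omega(\lambda)}$.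
   Context: $V$ is a finite-dimensional real vector space, $I$ a finite set; $(\alpha_i)_{i\in I}$ in $V^*$ and $(\alpha_i^\vee)_{i\in I}$ in $V$ are linearly independent families such that $(\alpha_j(\alpha_i^\vee))_{i,j\in I}$ is a generalized Cartan matrix. $r_i(v)=v-\alpha_i(v)\alpha_i^\vee$; $W^v=\langle r_i\mid i\in I\rangle\subset GL(V)$ is a Coxeter group with generators $r_i$ and length $\ell$; $\Phi=\{w(\alpha_i)\mid w\in W^v,i\in I\}$. $C^v_f=\{v\mid\alpha_i(v)>0\ \forall i\}$ and $\mathcal T=W^v\overline{C^v_f}$ is the Tits cone. $Y\subset V$ is a discrete subgroup with $\bigoplus_i\mathbb Z\alpha_i^\vee\subset Y\subset\{v\in V\mid\alpha(v)\in\mathbb Z\ \forall\alpha\in\Phi\}$, and $W=W^v\ltimes Y$. $\widetilde W=\widetilde W^v\ltimes Y$, where $\widetilde W^v\supset W^v$ is a group of linear bijections of $V$ stabilizing $\mathcal T$ and $Y$ and permuting the roots of $\Phi$ and the corresponding coroots. $\Omega$ is the stabilizer of $C^v_f$ in $\widetilde W^v$; then $\widetilde W^v=\Omega\ltimes W^v$, $\widetilde W=\Omega\ltimes W$, and $\Omega$ permutes $I$ by $\omega(\alpha_i)=\alpha_{\omega(i)}$, $\omega(\alpha_i^\vee)=\alpha_{\omega(i)}^\vee$. $\widetilde R=\mathbb Z[(\widetilde\sigma_i^{\pm1},(\widetilde\sigma_i')^{\pm1})_{i\in I}]$, where the indeterminates are subject only to the identifications: $\widetilde\sigma_i=\widetilde\sigma_i'$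 if $\alpha_i(Y)=\mathbb Z$; $\widetilde\sigma_i=\widetilde\sigma_j=\widetilde\sigma_i'=\widetilde\sigma_j'$ if $\alpha_i(\alpha_j^\vee)=\alpha_j(\alpha_i^\vee)=-1$; and $\widetilde\sigma_i=\widetilde\sigma_j$, $\widetilde\sigma_i'=\widetilde\sigma_j'$ if $\omega(i)=j$ for some $\omega\in\Omega$. ${}^{BL}\widetilde{\mathcal H}_{\widetilde R}$ is the free $\widetilde R$-module with basis denoted $(T_\omega Z^\lambda H_w)_{\omega\in\Omega,\lambda\in Y,w\in W^v}$; one writes $Z^\lambda H_w=T_1Z^\lambda H_w$, $H_w=T_1Z^0H_w$, $H_i=H_{r_i}$, $Z^\lambda=T_1Z^\lambda H_1$, $T_\omega=T_\omega Z^0H_1$. In (4) the right-hand side is computed in the group algebra $\widetilde R[Y]$ spanned by the $Z^\lambda$, by exact division (possible since $\widetilde\sigma_i=\widetilde\sigma_i'$ whenever $\alpha_i(\lambda)$ is odd). *)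

(* Defs.v *)
From HB Require Import structures.
From mathcomp Require Import all_boot all_order all_algebra finmap.
From mathcomp Require Import boolp classical_sets reals topology normedtype.
From mathcomp.multinomials Require Import -(notations) monalg.

Set Implicit Arguments.
Unset Strict Implicit.
Unset Printing Implicit Defensive.

Import Order.TTheory GRing.Theory Num.Theory numFieldNormedType.Exports.
Local Open Scope classical_set_scope.
Local Open Scope ring_scope.

(* The group algebra A[G] of an additive group G: finitely supported functions
   G -> A with the convolution product. Since [monalg] only multiplies over
   monoids without nontrivial units, the ring structure is built here on top of
   the free module [malg G A]; [mkmalgU k a] is a times the basis vector k. *)
Section GroupAlgebra.
Variables (A : comNzRingType) (G : zmodType).

Definition galg : Type := malg G A.
HB.instance Definition _ := GRing.Lmodule.on galg.

Implicit Types (x y z : galg) (k l : G) (a b : A).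

Definition gmon k : galg := mkmalgU k 1.

Definition galg_mul x y : galg :=
  \sum_(k <- msupp x) \sum_(l <- msupp y)
    mkmalgU (k + l)%R (mcoeff k x * mcoeff l y).

Lemma mkU0 k : mkmalgU k 0 = 0 :> galg.
Proof. exact: raddf0. Qed.

Lemma galgE (d : seq G) x : uniq d -> {subset (msupp x : seq G) <= d} ->
  x = \sum_(k <- d) mkmalgU k (mcoeff k x).
Proof.
move=> ud sd; apply/malgP => l; rewrite raddf_sum /=.
under eq_bigr do rewrite mcoeffU.
have [ld|ld] := boolP (l \in d).
  rewrite (bigD1_seq l) //= eqxx mulr1n big1 ?addr0 // => k /negPf kl.
  by rewrite kl.
rewrite big_seq big1 => [|k kd]; last first.
  by case: eqP kd ld => // -> ->.
by rewrite mcoeff_outdom //; apply: contra ld => /sd.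
Qed.

Lemma galg_mulE (d e : seq G) x y : uniq d -> uniq e ->
    {subset (msupp x : seq G) <= d} -> {subset (msupp y : seq G) <= e} ->
  galg_mul x y = \sum_(k <- d) \sum_(l <- e)
    mkmalgU (k + l)%R (mcoeff k x * mcoeff l y).
Proof.
have widen (r s : seq G) (F : G -> galg) : uniq r -> uniq s ->
    {subset r <= s} -> (forall k, k \notin r -> F k = 0) ->
    \sum_(k <- r) F k = \sum_(k <- s) F k.
  move=> ur us rs F0; rewrite [RHS](bigID (fun k => k \in r)) /=.
  rewrite [X in _ + X]big1 ?addr0; last by move=> k; apply: F0.
  rewrite -[RHS]big_filter; apply: perm_big; apply: uniq_perm => //.
    exact: filter_uniq.
  move=> k; rewrite mem_filter andb_idr //; exact: rs.
move=> ud ue sd se; rewrite /galg_mul.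
rewrite -(widen (msupp x) d) //; last 2 first.
- exact: fset_uniq.
- move=> k /mcoeff_outdom ->.
  by rewrite big1 // => l _; rewrite mul0r mkU0.
apply: eq_bigr => k _; apply: widen => //; first exact: fset_uniq.
by move=> l /mcoeff_outdom ->; rewrite mulr0 mkU0.
Qed.

Lemma galg_mulC : commutative galg_mul.
Proof.
move=> x y; rewrite /galg_mul exchange_big /=.
by apply: eq_bigr => k _; apply: eq_bigr => l _; rewrite addrC mulrC.
Qed.

Lemma galg_mulDl : left_distributive galg_mul +%R.
Proof.
move=> x y z.
pose d : seq G := undup (msupp x ++ msupp y ++ msupp (x + y)).
have sx : {subset (msupp x : seq G) <= d}.
  by move=> k kx; rewrite mem_undup !mem_cat kx.
have sy : {subset (msupp y : seq G) <= d}.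
  by move=> k ky; rewrite mem_undup !mem_cat ky orbT.
have sxy : {subset (msupp (x + y) : seq G) <= d}.
  by move=> k ky; rewrite mem_undup !mem_cat ky !orbT.
have ud : uniq d by exact: undup_uniq.
have uz : uniq (msupp z : seq G) by exact: fset_uniq.
rewrite !(@galg_mulE d (msupp z)) // -big_split /=.
apply: eq_bigr => k _; rewrite -big_split /=; apply: eq_bigr => l _.
by rewrite mcoeffD mulrDl raddfD.
Qed.

Lemma galg_mul0 x : galg_mul 0 x = 0.
Proof. by rewrite /galg_mul msupp0 big_nil. Qed.

Lemma galg_mulUU a b k l :
  galg_mul (mkmalgU k a) (mkmalgU l b) = mkmalgU (k + l)%R (a * b).
Proof.
rewrite (@galg_mulE [:: k] [:: l]) ?big_seq1 ?mcoeffUU //.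
  by move=> m; rewrite mem_seq1; have := fsubsetP (@msuppU_le _ _ k a) m;
     rewrite in_fset1.
by move=> m; rewrite mem_seq1; have := fsubsetP (@msuppU_le _ _ l b) m;
   rewrite in_fset1.
Qed.

Lemma galg_ind (P : galg -> Prop) : P 0 ->
  (forall x y, P x -> P y -> P (x + y)) -> (forall k a, P (mkmalgU k a)) ->
  forall x, P x.
Proof.
move=> P0 PD PU x; rewrite [x](galgE (fset_uniq (msupp x))) //.
by apply: big_ind => // k _; exact: PU.
Qed.

Lemma galg_mulDr x y z : galg_mul x (y + z) = galg_mul x y + galg_mul x z.
Proof. by rewrite ![galg_mul x _]galg_mulC galg_mulDl. Qed.

Lemma galg_mulr0 x : galg_mul x 0 = 0.
Proof. by rewrite galg_mulC galg_mul0. Qed.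

Lemma galg_mulA : associative galg_mul.
Proof.
move=> x y z; elim/galg_ind: x => [|x x' IH IH'|k a].
- by rewrite !galg_mul0.
- by rewrite !galg_mulDl IH IH'.
elim/galg_ind: y => [|y y' IH IH'|l b].
- by rewrite galg_mulr0 !galg_mul0 galg_mulr0.
- by rewrite galg_mulDl !galg_mulDr galg_mulDl IH IH'.
elim/galg_ind: z => [|z z' IH IH'|m c].
- by rewrite !galg_mulr0.
- by rewrite !galg_mulDr IH IH'.
by rewrite !galg_mulUU addrA mulrA.
Qed.

Lemma galg_mul1 : left_id (gmon 0) galg_mul.
Proof.
move=> x; elim/galg_ind: x => [|x y IH IH'|k a].
- exact: galg_mulr0.
- by rewrite galg_mulDr IH IH'.
by rewrite galg_mulUU add0r mul1r.
Qed.

Lemma galg_1neq0 : gmon 0 != 0.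
Proof. by rewrite monalgU_eq0 oner_eq0. Qed.

HB.instance Definition _ := GRing.Zmodule_isComNzRing.Build galg
  galg_mulA galg_mulC galg_mul1 galg_mulDl galg_1neq0.

Lemma galg_scaleU a k b : a *: (mkmalgU k b : galg) = mkmalgU k (a * b).
Proof. by apply/malgP => l; rewrite mcoeffZ !mcoeffU mulrnAr. Qed.

Lemma galg_scaleAl a x y : a *: (x * y) = (a *: x) * y.
Proof.
elim/galg_ind: x => [|x x' IH IH'|k b]; first by rewrite scaler0 !mul0r scaler0.
  by rewrite scalerDr !mulrDl scalerDr IH IH'.
elim/galg_ind: y => [|y y' IH IH'|l c]; first by rewrite !mulr0 scaler0.
  by rewrite !mulrDr scalerDr IH IH'.
by rewrite galg_scaleU /GRing.mul /= !galg_mulUU galg_scaleU mulrA.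
Qed.

HB.instance Definition _ := GRing.Lmodule_isLalgebra.Build A galg galg_scaleAl.
HB.instance Definition _ := GRing.Lalgebra_isComAlgebra.Build A galg.

End GroupAlgebra.

Section GeneralLinear.
Variables (K : fieldType) (V : vectType K).

Record GL := MkGL { glval :> 'End(V); glvalP : lker glval == 0%VS }.

HB.instance Definition _ := [isSub for glval].
HB.instance Definition _ := [Choice of GL by <:].

Lemma lker0_comp (f g : 'End(V)) :
  lker f == 0%VS -> lker g == 0%VS -> lker (f \o g)%VF == 0%VS.
Proof.
move=> /lker0P fi /lker0P gi; apply/lker0P => u v.
by rewrite !comp_lfunE => /fi /gi.
Qed.

Lemma lker0_inv (f : 'End(V)) : lker f == 0%VS -> lker (f^-1)%VF == 0%VS.
Proof.
move=> f0; apply/lker0P => u v /(congr1 f).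
by rewrite -![f (_ _)]comp_lfunE lker0_compfV // !id_lfunE.
Qed.

Lemma lker0_id : lker (\1%VF : 'End(V)) == 0%VS.
Proof. by apply/lker0P => u v; rewrite !id_lfunE. Qed.

Definition gl_mul (f g : GL) := MkGL (lker0_comp (glvalP f) (glvalP g)).
Definition gl_inv (f : GL) := MkGL (lker0_inv (glvalP f)).
Definition gl_one := MkGL lker0_id.

Lemma gl_mulA : associative gl_mul.
Proof. by move=> f g h; apply: val_inj; rewrite /= comp_lfunA. Qed.
Lemma gl_mul1 : left_id gl_one gl_mul.
Proof. by move=> f; apply: val_inj; rewrite /= comp_lfun1l. Qed.
Lemma gl_mulr1 : right_id gl_one gl_mul.
Proof. by move=> f; apply: val_inj; rewrite /= comp_lfun1r. Qed.
Lemma gl_mulV : left_inverse gl_one gl_inv gl_mul.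
Proof.
by move=> f; apply: val_inj; rewrite /= lker0_compVf //; exact: glvalP.
Qed.
Lemma gl_mulrV : right_inverse gl_one gl_inv gl_mul.
Proof.
by move=> f; apply: val_inj; rewrite /= lker0_compfV //; exact: glvalP.
Qed.

HB.instance Definition _ :=
  isGroup.Build GL gl_mulA gl_mul1 gl_mulr1 gl_mulV gl_mulrV.

Lemma gl1E (v : V) : (1%g : GL) v = v.
Proof. exact: id_lfunE. Qed.
Lemma glME (f g : GL) (v : V) : (f * g)%g v = f (g v).
Proof. exact: comp_lfunE. Qed.
Lemma glVK (f : GL) (v : V) : (f^-1)%g (f v) = v.
Proof. by rewrite -glME mulVg gl1E. Qed.
Lemma glKV (f : GL) (v : V) : f ((f^-1)%g v) = v.
Proof. by rewrite -glME mulgV gl1E. Qed.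

(* contragredient action on the dual space V^* = 'Hom(V, K^o) *)
Definition gl_dual (g : GL) (f : 'Hom(V, K^o)) : 'Hom(V, K^o) :=
  (f \o glval (g^-1)%g)%VF.

Lemma gl_stab_closed (A : set V) :
  group_closed (fun g : GL => `[< g @` A = A >]).
Proof.
split.
  rewrite unfold_in; apply/asboolP/seteqP; split => [_ [v Av <-]|v Av].
    by rewrite gl1E.
  by exists v => //; rewrite gl1E.
move=> g h /asboolP gA /asboolP hA; rewrite unfold_in; apply/asboolP.
rewrite -[in LHS]hA image_comp -[RHS]gA; apply: eq_imagel => v _; rewrite /comp.
by rewrite [LHS]glME glVK.
Qed.

End GeneralLinear.

Definition subgroup_gen (G : groupType) (S : set G) : set G :=
  smallest (fun H : set G => group_closed [in H]) S.

Lemma subgroup_gen_closed (G : groupType) (S : set G) :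
  group_closed [in subgroup_gen S].
Proof.
split; first by apply/mem_set => H [[/set_mem ? _] _].
move=> g h /set_mem gS /set_mem hS; apply/mem_set => H HS.
by apply/set_mem/HS.1.2; apply/mem_set; [exact: gS|exact: hS].
Qed.

(* A finite-dimensional real space carries no topology in the library; the usual
   one is transported from R^n through a basis, on which it does not depend. *)
Definition vtop (R : realType) (V : vectType R) : topologicalType :=
  initial_topology (passmx.rVof (vbasis {:V})).

(* the cartan_* fields say that (alpha_j(alpha_i^vee))_(i,j) is a generalized
   Cartan matrix *)
Record rootDatum (R : realType) := RootDatum {
  spaceV :> vectType R;
  indexI : finType;
  alpha : indexI -> 'Hom(spaceV, R^o);
  alphav : indexI -> spaceV;
  alpha_free : free [seq alpha i | i <- enum indexI];
  alphav_free : free [seq alphav i | i <- enum indexI];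
  cartan_diag : forall i, alpha i (alphav i) = 2;
  cartan_int : forall i j, (alpha j (alphav i) : R) \is a Num.int;
  cartan_le0 : forall i j, i != j -> (alpha j (alphav i) : R) <= 0;
  cartan_sym0 : forall i j, alpha j (alphav i) = 0 <-> alpha i (alphav j) = 0
}.
Arguments alpha {R D} : rename.
Arguments alphav {R D} : rename.

Section Weyl.
Variables (R : realType) (D : rootDatum R).
Local Notation V := (spaceV D).
Local Notation I := (indexI D).

Definition refl_fun (i : I) (v : V) : V :=
  v - (alpha i v : R) *: alphav i.

Lemma refl_fun_linear i : linear (refl_fun i).
Proof.
move=> a u v; rewrite /refl_fun linearP /= scalerDl scalerBr opprD addrACA.
by rewrite scalerA.
Qed.

HB.instance Definition _ i := GRing.isLinear.Build R V V _ (refl_fun i)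
  (@refl_fun_linear i).

Lemma refl_funK i : involutive (refl_fun i).
Proof.
move=> v; rewrite /refl_fun.
have -> : alpha i (v - (alpha i v : R) *: alphav i) = - alpha i v.
  rewrite [LHS]linearB [X in _ - X]linearZ /= cartan_diag /GRing.scale /=.
  by rewrite mulr_natr mulr2n opprD addrA subrr add0r.
by rewrite scaleNr opprK subrK.
Qed.

Lemma refl_ker i : lker (linfun (refl_fun i)) == 0%VS.
Proof.
by apply/lker0P => u v; rewrite !lfunE /=; exact: (can_inj (refl_funK i)).
Qed.

Definition refl (i : I) : GL V := MkGL (refl_ker i).

Lemma reflE i v : refl i v = v - (alpha i v : R) *: alphav i.
Proof. exact: lfunE. Qed.

Lemma reflV i : (refl i)^-1%g = refl i.
Proof.
apply: (@mulgI _ (refl i)); rewrite mulgV; apply/val_inj/lfunP => v.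
by rewrite gl1E glME !lfunE /= refl_funK.
Qed.

Definition weyl : {pred GL V} := [in subgroup_gen [set refl i | i in setT]].

Lemma weyl_closed : group_closed weyl.
Proof. exact: subgroup_gen_closed. Qed.

Lemma refl_weyl i : refl i \in weyl.
Proof. by apply/mem_set => H [_]; apply; exists i. Qed.

Record weylT := WeylT { wval :> GL V; wvalP : wval \in weyl }.
HB.instance Definition _ := [isSub for wval].
HB.instance Definition _ := [Choice of weylT by <:].
HB.instance Definition _ :=
  SubChoice_isSubGroup.Build (GL V) weyl weylT weyl_closed.

Definition srefl (i : I) : weylT := WeylT (refl_weyl i).

Lemma weyl_word (w : weylT) :
  exists n, `[< exists s : seq I, size s = n /\ w = (\prod_(i <- s) srefl i)%g >].
Proof.
pose H := [set g : GL V | exists s : seq I, g = (\prod_(i <- s) refl i)%g].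
have Hw : H w.
  have /set_mem := wvalP w; apply; split; last first.
    by move=> _ [i _ <-]; exists [:: i]; rewrite big_seq1.
  split; first by apply/mem_set; exists [::]; rewrite big_nil.
  move=> _ _ /set_mem[s ->] /set_mem[t ->]; apply/mem_set; exists (s ++ rev t); rewrite big_cat /=.
  congr (_ * _)%g; elim: t => [|i t IH]; first by rewrite !big_nil invg1.
  by rewrite rev_cons -cats1 big_cat big_seq1 big_cons invgM IH reflV.
have [s ws] := Hw; exists (size s); apply/asboolP; exists s; split=> //.
apply: val_inj; rewrite /= ws; elim: s {ws} => [|i s IH].
  by rewrite !big_nil.
by rewrite !big_cons IH.
Qed.

(* Coxeter length: the least length of a word in the r_i representing w *)
Definition ell (w : weylT) : nat := ex_minn (weyl_word w).

(* [coroot_of a c]: a = w(alpha_i) is a root and c = w(alpha_i^vee) its coroot *)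
Definition coroot_of (a : 'Hom(V, R^o)) (c : V) : Prop :=
  exists (w : weylT) (i : I), a = gl_dual w (alpha i) /\ c = w (alphav i).

Definition Phi : set 'Hom(V, R^o) :=
  [set a | exists (w : weylT) (i : I), a = gl_dual w (alpha i)].

Definition chamber : set V := [set v | forall i, 0 < (alpha i v : R)].

Definition tits_cone : set V :=
  \bigcup_(w in [set: weylT])
    (w : GL V) @` (closure (chamber : set (vtop V)) : set V).

End Weyl.

Arguments weyl {R} D.
Arguments Phi {R} D.
Arguments chamber {R} D.
Arguments tits_cone {R} D.

(* [latY] is Y and [eWeyl] is the extended vectorial Weyl group ~W^v. Boolean
   predicates are arbitrary subsets here, classical logic being assumed. *)
Record extDatum (R : realType) (D : rootDatum R) := ExtDatum {
  latY : {pred D};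
  latY_zmod : zmod_closed latY;
  latY_discrete :
    ([set` latY] : set (vtop D)) `<=` isolated ([set` latY] : set (vtop D));
  latY_coroots : forall n : indexI D -> int, \sum_i alphav i *~ n i \in latY;
  latY_int : forall y, y \in latY -> forall a : 'Hom(D, R^o), Phi D a ->
    (a y : R) \is a Num.int;
  eWeyl : {pred GL D};
  eWeyl_group : group_closed eWeyl;
  eWeyl_weyl : {subset weyl D <= eWeyl};
  eWeyl_tits : forall g, g \in eWeyl -> g @` tits_cone D = tits_cone D;
  eWeyl_latY : forall g, g \in eWeyl -> g @` [set` latY] = [set` latY];
  eWeyl_roots : forall g, g \in eWeyl -> forall a c,
    coroot_of (gl_dual g a) (g c) <-> coroot_of a c
}.

Section BernsteinLusztig.
Variables (R : realType) (D : rootDatum R) (E : extDatum D).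
Local Notation V := (spaceV D).
Local Notation I := (indexI D).
Local Notation W := (weylT D).

Record latT := LatT { yval :> V; yvalP : yval \in latY E }.
HB.instance Definition _ := [isSub for yval].
HB.instance Definition _ := [Choice of latT by <:].
HB.instance Definition _ :=
  GRing.SubChoice_isSubZmodule.Build V (latY E) latT (latY_zmod E).

(* the stabilizer of the chamber in ~W^v *)
Definition Omega : {pred GL V} :=
  fun g => (g \in eWeyl E) && `[< g @` chamber D = chamber D >].

Lemma Omega_closed : group_closed Omega.
Proof.
have [e1 eV] := eWeyl_group E; have [c1 cV] := gl_stab_closed (chamber D).
split; first by apply/andP.
move=> g h /andP[ge gc] /andP[he hc]; apply/andP; split; first exact: eV.
exact: cV.
Qed.

Record OmegaT := MkOmega { oval :> GL V; ovalP : oval \in Omega }.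
HB.instance Definition _ := [isSub for oval].
HB.instance Definition _ := [Choice of OmegaT by <:].
HB.instance Definition _ :=
  SubChoice_isSubGroup.Build (GL V) Omega OmegaT Omega_closed.

Lemma alphavY_subproof i : alphav i \in latY E.
Proof.
have := latY_coroots E (fun j => (j == i)%:Z).
rewrite (bigD1 i) //= eqxx mulr1z big1 ?addr0 // => j /negPf ->.
by rewrite mulr0z.
Qed.
Definition alphavY (i : I) : latT := LatT (alphavY_subproof i).

Lemma reflY_subproof i (y : latT) : refl i (yval y) \in latY E.
Proof.
have i_eW : refl i \in eWeyl E by apply/eWeyl_weyl/refl_weyl.
have := eWeyl_latY i_eW => /seteqP[+ _]; apply; exists (yval y) => //.
exact: yvalP.
Qed.
Definition reflY (i : I) (y : latT) : latT := LatT (reflY_subproof i y).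

Lemma omegaY_subproof (o : OmegaT) (y : latT) : o (yval y) \in latY E.
Proof.
have /andP[oe _] := ovalP o.
have := eWeyl_latY oe => /seteqP[+ _]; apply; exists (yval y) => //.
exact: yvalP.
Qed.
Definition omegaY (o : OmegaT) (y : latT) : latT := LatT (omegaY_subproof o y).

(* The permutation of I induced by o; the index j exists and is unique, so the
   default value i is never used. *)
Definition omegaI (o : OmegaT) (i : I) : I :=
  odflt i [pick j | (gl_dual o (alpha i) == alpha j) &&
                    (o (alphav i) == alphav j)].

(* (false, i) and (true, i) stand for the symbols sigma_i and sigma'_i. *)
Inductive param_ident : bool * I -> bool * I -> Prop :=
| ident_unramified i of
    [set (alpha i y : R) | y in [set` latY E]] =
    [set x : R | x \is a Num.int] :
    param_ident (false, i) (true, i)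
| ident_braid i j b c of alpha i (alphav j) = -1 & alpha j (alphav i) = -1 :
    param_ident (b, i) (c, j)
| ident_omega (o : OmegaT) i b : param_ident (b, i) (b, omegaI o i).

Definition param_rel : rel (bool * I) :=
  [rel x y | `[< param_ident x y >] || `[< param_ident y x >]].

Lemma param_rel_sym : connect_sym param_rel.
Proof. by apply: sym_connect_sym => x y; exact: orbC. Qed.

(* The indeterminates are the classes of the generated equivalence relation,
   each given by its canonical representative. *)
Definition indet := {x : bool * I | fingraph.roots param_rel x}.
Definition indet_of (x : bool * I) : indet :=
  exist _ (fingraph.root param_rel x) (roots_root param_rel_sym x).

(* Laurent polynomials over Z: the group ring of the exponents Z^indet *)
Definition Rt := galg int {ffun indet -> int}.
HB.instance Definition _ := GRing.ComNzRing.on Rt.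

Definition indet_pow (x : indet) (n : int) : Rt :=
  gmon int [ffun y => n *+ (y == x)].

Definition sigma (i : I) : Rt := indet_pow (indet_of (false, i)) 1.
Definition sigmaV (i : I) : Rt := indet_pow (indet_of (false, i)) (-1).
Definition sigma' (i : I) : Rt := indet_pow (indet_of (true, i)) 1.
Definition sigmaV' (i : I) : Rt := indet_pow (indet_of (true, i)) (-1).

(* the free Rt-module with basis (T_o Z^y H_w) *)
Definition BLH := malg (OmegaT * latT * W)%type Rt.
HB.instance Definition _ := GRing.Lmodule.on BLH.

Definition TZH (o : OmegaT) (y : latT) (w : W) : BLH := mkmalgU (o, y, w) 1.

Definition ZH (y : latT) (w : W) : BLH := TZH 1%g y w.
Definition Hw (w : W) : BLH := TZH 1%g 0 w.
Definition Hi (i : I) : BLH := Hw (srefl i).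
Definition Zy (y : latT) : BLH := TZH 1%g y 1%g.
Definition To (o : OmegaT) : BLH := TZH o 0 1%g.

Definition RY := galg Rt latT.
HB.instance Definition _ := GRing.ComAlgebra.on RY.
Definition ZY (y : latT) : RY := gmon Rt y.

(* the embedding of the group algebra, Z^y |-> T_1 Z^y H_1 *)
Definition RY_to_BLH (p : RY) : BLH := \sum_(y <- msupp p) mcoeff y p *: Zy y.

(* q = b(sigma_i, sigma'_i; z) * p with z = Z^(- alpha_i^vee): the denominator
   1 - z^2 is not a zero divisor, so there is at most one such q. *)
Definition is_b_mul (i : I) (p q : RY) : Prop :=
  let z := ZY (- alphavY i) in
  q * (1 - z ^+ 2) =
  ((sigma i - sigmaV i)%:A + (sigma' i - sigmaV' i) *: z) * p.

Record BL_algebra (mul : BLH -> BLH -> BLH) : Prop := BLAlgebra {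
  BL_linearl : forall y, linear (mul^~ y);
  BL_linearr : forall x, linear (mul x);
  BL_assoc : associative mul;
  BL_unitl : left_id (Hw 1%g) mul;
  BL_unitr : right_id (Hw 1%g) mul;
  BL_TZH : forall o y w, mul (To o) (ZH y w) = TZH o y w;
  BL_ZH : forall y w, mul (Zy y) (Hw w) = ZH y w;
  BL_HH_gt : forall i w, (ell w < ell (srefl i * w)%g)%N ->
    mul (Hi i) (Hw w) = Hw (srefl i * w)%g;
  BL_HH_lt : forall i w, (ell (srefl i * w)%g < ell w)%N ->
    mul (Hi i) (Hw w) =
    (sigma i - sigmaV i) *: Hw w + Hw (srefl i * w)%g;
  BL_ZZ : forall y y', mul (Zy y) (Zy y') = Zy (y + y');
  BL_HZ : forall y i, exists2 q : RY,
    is_b_mul i (ZY y - ZY (reflY i y)) q &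
    mul (Hi i) (Zy y) - mul (Zy (reflY i y)) (Hi i) = RY_to_BLH q;
  BL_TT : forall o o', mul (To o) (To o') = To (o * o')%g;
  BL_conj : forall o, exists ToV : BLH,
    [/\ mul (To o) ToV = Hw 1%g, mul ToV (To o) = Hw 1%g,
        forall i, mul (mul (To o) (Hi i)) ToV = Hi (omegaI o i) &
        forall y, mul (mul (To o) (Zy y)) ToV = Zy (omegaY o y)]
}.

End BernsteinLusztig.

(* Main.v *)
Require Import Defs.
From HB Require Import structures.
From mathcomp Require Import all_boot all_order all_algebra finmap.
From mathcomp Require Import boolp classical_sets reals.
From mathcomp.multinomials Require Import -(notations) monalg.
From mathcomp Require Import zify ring lra.

Set Implicit Arguments.
Unset Strict Implicit.
Unset Printing Implicit Defensive.

Import Order.TTheory GRing.Theory Num.Theory.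
Local Open Scope classical_set_scope.
Local Open Scope ring_scope.

(* Uniqueness: the relations determine left multiplication by T_omega, Z^lambda
   and H_i on the basis, and these elements generate the algebra.

   Existence: R~[Y] embeds into a field K, being the group algebra over a domain
   of an orderable group. The Demazure-Lusztig elements b_i + (sigma_i - b_i) r_i
   of the twisted group algebra K * (Omega |x W^v), realized as operators on
   functions, satisfy the quadratic relations and (4); their braid relations are
   identities between rational functions, one for each of A1xA1, A2, B2, G2, so
   Matsumoto's theorem gives operators H_w. The operators T_omega Z^lambda H_w
   are linearly independent by triangularity for the length, and their span is
   closed under composition.

   Matsumoto's theorem rests on the positivity of w(alpha_i) when
   l(w r_i) >= l(w). Positivity also shows that Omega permutes the simple roots
   and coroots. *)

(** * Words and rank-two subgroups of the Weyl group *)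

(** Defining the product on basis elements by the relations would leave associativity to be verified
    case by case. Composition of operators is associative outright, and the work moves to closure of
    a span and to linear independence. A field is wanted because b has the denominator [1 - z^2],
    and because independence rests on the coefficients [sigma_i - b_i] being nonzero: cleared of
    denominators, they have the unit [sigma_i^-1] as constant term. The operators act on functions
    through right multiplication in [~W^v], so a braid relation involves one coset of [<r_s, r_t>]
    at a time. Read as a cycle of length 2m, it meets the positive coroots of rank two and then
    their opposites, where b becomes [p - b]. The identifications of parameters enter in three ways.
    An odd value of [alpha_i] on Y forces [sigma_i = sigma_i'], which makes the division in (4)
    exact and simplifies b to [p / (1 - z)]. Two Cartan entries -1 equate the parameters of type A2.
    Invariance under Omega lets [T_omega] permute the [H_i]. *)

Section WeylGroup.
Variables (R : realType) (D : rootDatum R).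
Local Notation V := (spaceV D).
Local Notation I := (indexI D).
Local Notation W := (weylT D).

Implicit Types (w u : W) (i j k t : I) (x v : V).

Lemma wM w u v : (w * u)%g v = w (u v).
Proof. exact: glME. Qed.

Lemma wK w v : (w^-1)%g (w v) = v.
Proof. exact: glVK. Qed.

Lemma wKV w v : w ((w^-1)%g v) = v.
Proof. exact: glKV. Qed.

Lemma w1 v : (1%g : W) v = v.
Proof. exact: gl1E. Qed.

Lemma weyl_ext w u : (forall v, w v = u v) -> w = u.
Proof. by move=> wu; do 2!apply: val_inj; apply/lfunP. Qed.

Lemma sreflE i v : srefl i v = v - (alpha i v : R) *: alphav i.
Proof. exact: reflE. Qed.

Lemma sreflV i : (srefl i)^-1%g = srefl i.
Proof. apply: val_inj; exact: reflV. Qed.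

Lemma srefl_sq i : (srefl i * srefl i = 1)%g.
Proof. by rewrite -{1}sreflV mulVg. Qed.

Lemma mulg_sreflK i : involutive (fun w => w * srefl i)%g.
Proof. by move=> w; rewrite -mulgA srefl_sq mulg1. Qed.

Lemma alphaB i v x : alpha i (v - x) = alpha i v - alpha i x.
Proof. exact: linearB. Qed.
Lemma alphaD i v x : alpha i (v + x) = alpha i v + alpha i x.
Proof. exact: linearD. Qed.
Lemma alphaZ i (a : R) v : alpha i (a *: v) = a * alpha i v.
Proof. exact: linearZ. Qed.

Lemma alpha_srefl i j v :
  alpha i (srefl j v) = alpha i v - alpha j v * alpha i (alphav j) :> R.
Proof. by rewrite sreflE alphaB alphaZ. Qed.

Definition wordp (s : seq I) : W := (\prod_(i <- s) srefl i)%g.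

Lemma wordp_nil : wordp [::] = 1%g. Proof. exact: big_nil. Qed.
Lemma wordp_cons i s : wordp (i :: s) = (srefl i * wordp s)%g.
Proof. exact: big_cons. Qed.
Lemma wordp_cat s1 s2 : wordp (s1 ++ s2) = (wordp s1 * wordp s2)%g.
Proof. exact: big_cat. Qed.
Lemma wordp_rcons s i : wordp (rcons s i) = (wordp s * srefl i)%g.
Proof. by rewrite -cats1 wordp_cat /wordp big_seq1. Qed.

Lemma ell_word w : exists2 s, size s = ell w & w = wordp s.
Proof.
by rewrite /ell; case: ex_minnP => n /asboolP[s [sn ws]] _; exists s.
Qed.

Lemma ell_wordp s : (ell (wordp s) <= size s)%N.
Proof.
rewrite /ell; case: ex_minnP => n _; apply; apply/asboolP; by exists s.
Qed.

Lemma ell1 : ell (1%g : W) = 0%N.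
Proof. by apply/eqP; rewrite -leqn0 -wordp_nil ell_wordp. Qed.

Lemma ell_mul_wordp w s : (ell (w * wordp s)%g <= ell w + size s)%N.
Proof.
have [r <- ->] := ell_word w; rewrite -wordp_cat -size_cat; exact: ell_wordp.
Qed.

Lemma ell_mul w u : (ell (w * u)%g <= ell w + ell u)%N.
Proof. by have [r <- ->] := ell_word u; exact: ell_mul_wordp. Qed.

Lemma ell_mulr w i : (ell (w * srefl i)%g <= (ell w).+1)%N.
Proof.
by have := ell_mul_wordp w [:: i]; rewrite /wordp big_seq1 /= addn1.
Qed.

Lemma ell_mulr_ge w i : (ell w <= (ell (w * srefl i)%g).+1)%N.
Proof. by have := ell_mulr (w * srefl i)%g i; rewrite mulg_sreflK. Qed.

Lemma exists_descent w : w != 1%g -> exists t, (ell (w * srefl t)%g < ell w)%N.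
Proof.
have [s ss ws] := ell_word w; rewrite -ss ws; case/lastP: s {ss ws} => [|s t _].
  by rewrite wordp_nil eqxx.
by exists t; rewrite wordp_rcons mulg_sreflK size_rcons ltnS ell_wordp.
Qed.

Lemma reduced_rcons s i : size (rcons s i) = ell (wordp (rcons s i)) ->
  size s = ell (wordp s).
Proof.
rewrite wordp_rcons size_rcons => h.
by have := ell_mulr (wordp s) i; have := ell_wordp s; lia.
Qed.

(* The alternating word of length n in s, t whose last letter is t. *)
Fixpoint altw s t n : seq I :=
  if n is m.+1 then rcons (altw t s m) t else [::].

Lemma size_altw s t n : size (altw s t n) = n.
Proof. by elim: n s t => //= n IH s t; rewrite size_rcons IH. Qed.

Lemma altwS s t n :
  altw s t n.+1 = (if odd n then s else t) :: altw s t n.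
Proof.
elim: n s t => [|n IH] s t //.
rewrite [LHS]/= -/(altw t s n.+1) IH rcons_cons /=; by case: odd.
Qed.

Notation altp s t n := (wordp (altw s t n)).

Lemma altp_split s t m n :
  exists2 u : W, (ell u <= m)%N & altp s t (m + n) = (u * altp s t n)%g.
Proof.
elim: n s t => [|n IH] s t.
  exists (altp s t m); last by rewrite addn0 wordp_nil mulg1.
  by rewrite -{2}(size_altw s t m) ell_wordp.
have [u um e] := IH t s; exists u => //.
by rewrite addnS /= !wordp_rcons e mulgA.
Qed.

(** The integer m with [c = 4 cos^2(pi/m)], that is, the order of [r_s r_t]; the value 0 encodes
    infinite order. *)
Definition cox s t : nat :=
  let c := alpha s (alphav t) * alpha t (alphav s) : R in
  if c == 0 then 2%N else if c == 1 then 3%N else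
  if c == 2 then 4%N else if c == 3 then 6%N else 0%N.

Variant cox_spec : R -> R -> nat -> Prop :=
| CoxA1A1 : cox_spec 0 0 2%N
| CoxA2 : cox_spec (-1) (-1) 3%N
| CoxB2 : cox_spec (-1) (-2) 4%N
| CoxC2 : cox_spec (-2) (-1) 4%N
| CoxG2 : cox_spec (-1) (-3) 6%N
| CoxG2' : cox_spec (-3) (-1) 6%N
| CoxInf a b of a < 0 & b < 0 & 4 <= a * b : cox_spec a b 0%N.

Lemma cartan_nat s t : s != t -> exists n : nat, alpha s (alphav t) = - n%:R :> R.
Proof.
move=> st; have /intrP[z ez] := cartan_int t s.
have := @cartan_le0 _ D t s; rewrite eq_sym ez => /(_ st).
rewrite lerz0 => z0; exists `|z|%N.
by rewrite natr_absz ler0_norm // mulrNz opprK.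
Qed.

Lemma coxP s t : s != t ->
  cox_spec (alpha s (alphav t)) (alpha t (alphav s)) (cox s t).
Proof.
move=> st; have ts : t != s by rewrite eq_sym.
have [n en] := cartan_nat st; have [m em] := cartan_nat ts.
have := cartan_sym0 s t; rewrite /cox en em => -[h1 h2].
rewrite mulrNN -natrM !(eqr_nat R _ 0, eqr_nat R _ 1, eqr_nat R _ 2, eqr_nat R _ 3).
have nm : (n == 0%N) = (m == 0%N).
  by apply/eqP/eqP => e; move: h1 h2; rewrite e oppr0 => h1 h2;
    [have /eqP := h2 erefl|have /eqP := h1 erefl]; rewrite oppr_eq0 pnatr_eq0 => /eqP.
case: n nm {en h1 h2} => [|n]; case: m {em} => [|m] // _.
  by rewrite mul0n eqxx oppr0; constructor.
rewrite muln_eq0 /=; case: eqP => [e|h1].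
  have [-> ->] : n = 0%N /\ m = 0%N by lia.
  exact: CoxA2.
case: eqP => [e|h2].
  have [[-> ->]|[-> ->]] : (n = 0 /\ m = 1 \/ n = 1 /\ m = 0)%N by nia.
    exact: CoxB2.
  exact: CoxC2.
case: eqP => [e|h3].
  have [[-> ->]|[-> ->]] : (n = 0 /\ m = 2 \/ n = 2 /\ m = 0)%N by nia.
    exact: CoxG2.
  exact: CoxG2'.
apply: CoxInf; rewrite ?oppr_lt0 ?ltr0n // mulrNN -natrM (ler_nat R 4).
by nia.
Qed.

Lemma coxC s t : cox s t = cox t s.
Proof. by rewrite /cox mulrC. Qed.

(** Coordinates on [alpha_s], [alpha_t] of the root [w(alpha_s)], where w is the alternating word of
    length n ending in t. Lengthening this word adds a letter on the left, so each step is one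
    reflection of the root. *)
Fixpoint alt_coef s t n : R * R :=
  if n is m.+1 then
    let: (x, y) := alt_coef s t m in
    if odd m then (- x - alpha t (alphav s) * y, y)
    else (x, - y - alpha s (alphav t) * x)
  else (1, 0).

Lemma alt_coefE s t n v :
  alpha s ((altp s t n)^-1%g v) =
  (alt_coef s t n).1 * alpha s v + (alt_coef s t n).2 * alpha t v.
Proof.
elim: n v => [|n IH] v; first by rewrite wordp_nil invg1 w1 /= mul1r mul0r addr0.
rewrite altwS wordp_cons invgM sreflV wM IH /=.
have a2 i : alpha i (alphav i) = 2 :> R by exact: cartan_diag.
case: (alt_coef s t n) => x y /=.
by case: odd => /=; rewrite !alpha_srefl !a2; ring.
Qed.

(** A finite m leaves at most six values of n, which are computed outright; when the product of the
    two Cartan entries is at least 4, an invariant is propagated instead. *)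
Lemma alt_coef_ge0 s t n : s != t -> (cox s t == 0) || (n < cox s t)%N ->
  [/\ 0 <= (alt_coef s t n).1, 0 <= (alt_coef s t n).2 &
      0 < (alt_coef s t n).1 + (alt_coef s t n).2].
Proof.
move=> st.
suff inf a b : a < 0 -> b < 0 -> 4 <= a * b ->
    alpha s (alphav t) = a -> alpha t (alphav s) = b ->
    [/\ 0 <= (alt_coef s t n).1, 0 <= (alt_coef s t n).2 &
      0 < (alt_coef s t n).1 + (alt_coef s t n).2].
{ move: inf; have := coxP st.
  move E1 : (alpha s (alphav t) : R) => a; move E2 : (alpha t (alphav s) : R) => b.
  move=> sp; case: sp E1 E2 => [||||||{}a {}b a0 b0 ab] E1 E2 inf.
  7: by move=> _; apply: (inf a b).
  all: clear inf; do 6?[case: n => [|n]]; rewrite //= => _.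
  all: try by split; lra.
  all: by rewrite ?E1 ?E2 /=; split; lra. }
move=> a0 b0 ab ea eb.
(* The coordinate reflected last is positive and bounds the other one. From [2x <= -by] the next
   value [x' = -x - by] is at least [-by/2], so [-ax' >= aby/2 >= 2y]; this is where [4 <= ab]
   enters. *)
suff: let: (x, y) := alt_coef s t n in
    if odd n then [/\ 0 < y, 0 <= x & 2 * x <= - b * y]
    else [/\ 0 < x, 0 <= y & 2 * y <= - a * x].
  by case: (alt_coef s t n) => x y; case: odd => -[? ? ?] /=; split=> //; lra.
elim: n => [|n IH] /=; first by split; lra.
move: IH; rewrite ea eb; case: (alt_coef s t n) => x y.
case: odd => /= -[h1 h2 h3].
  have h4 : 0 <= (a * b - 4) * y by rewrite mulr_ge0 ?subr_ge0 // ltW.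
  have h5 : 0 <= - a * (- b * y - 2 * x) by rewrite mulr_ge0 ?subr_ge0 // oppr_ge0 ltW.
  have h6 : 0 < - b * y by rewrite mulr_gt0 ?oppr_gt0.
  by split; lra.
have h4 : 0 <= (a * b - 4) * x by rewrite mulr_ge0 ?subr_ge0 // ltW.
have h5 : 0 <= - b * (- a * x - 2 * y) by rewrite mulr_ge0 ?subr_ge0 // oppr_ge0 ltW.
have h6 : 0 < - a * x by rewrite mulr_gt0 ?oppr_gt0.
by split; lra.
Qed.

Lemma srefl_plane s t v (x y : R) :
  srefl s (v + x *: alphav s + y *: alphav t) =
  v + (- x - alpha s v - alpha s (alphav t) * y) *: alphav s + y *: alphav t.
Proof.
rewrite sreflE !alphaD !alphaZ cartan_diag -!addrA; congr (_ + _).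
rewrite [LHS]addrA [LHS]addrAC -scalerBl; congr (_ *: _ + _).
by ring.
Qed.

Lemma srefl_plane' s t v (x y : R) :
  srefl t (v + x *: alphav s + y *: alphav t) =
  v + x *: alphav s + (- y - alpha t v - alpha t (alphav s) * x) *: alphav t.
Proof. by rewrite addrAC srefl_plane addrAC. Qed.

Lemma altp_cox s t : s != t -> (0 < cox s t)%N ->
  altp s t (cox s t) = altp t s (cox s t).
Proof.
move=> st; have := coxP st.
move E1 : (alpha s (alphav t) : R) => a; move E2 : (alpha t (alphav s) : R) => b.
move=> sp; case: sp E1 E2 => [||||||{}a {}b a0 b0 ab] E1 E2 // _.
all: apply: weyl_ext => v.
all: rewrite /= ?wordp_nil ?wordp_cons ?w1 ?wM.
(* From this form on, each reflection changes only one of the two coefficients, and the claim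
   becomes a polynomial identity in [alpha_s(v)] and [alpha_t(v)]. *)
all: have {1 2}-> : v = v + 0 *: alphav s + 0 *: alphav t by rewrite !scale0r !addr0.
all: rewrite !wordp_nil !w1 !(srefl_plane, srefl_plane') E1 E2.
all: by congr (_ + _ *: _ + _ *: _); ring.
Qed.

End WeylGroup.

(** * Positive roots and Matsumoto's theorem *)

Section Positivity.
Variables (R : realType) (D : rootDatum R).
Local Notation V := (spaceV D).
Local Notation I := (indexI D).
Local Notation W := (weylT D).
Local Notation altp s t n := (wordp (altw s t n)).

Implicit Types (w u : W) (i j : I) (v : V).

(** Linear independence of the [alpha_i] enters here: it makes the chamber nonempty and allows the
    coefficients of a combination of simple roots to be tested on suitable vectors. *)
Lemma alpha_surj (c : I -> R) : exists v : V, forall i, alpha i v = c i.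
Proof.
pose e := vbasis {:V}.
pose A : 'M[R]_(\dim {:V}, #|I|) := \matrix_(k, i) alpha (enum_val i) e`_k.
have Afree : row_free A^T.
  apply: inj_row_free => u uA.
  have /freeP fr := alpha_free D.
  apply/rowP => i; rewrite mxE; move: i.
  apply: (fr (u ord0)); apply/lfunP => v.
  rewrite (coord_basis (vbasisP {:V}) (memvf v)) zero_lfunE.
  rewrite [LHS]linear_sum big1 // => l _; rewrite linearZ /=.
  apply/eqP; rewrite scaler_eq0; apply/orP; right; apply/eqP.
  rewrite sum_lfunE; have /rowP/(_ l) := uA; rewrite !mxE => uAl.
  rewrite -[RHS]uAl.
  apply: eq_bigr => i _; rewrite !mxE scale_lfunE; congr (_ *: _).
  have iI : (i < size (enum I))%N by rewrite -cardE.
  rewrite (nth_map (enum_val i)) //.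
  by rewrite -enum_val_nth.
have : row_full A by rewrite /row_full -mxrank_tr.
case/row_fullP => B BA.
pose u := (\row_i c (enum_val i)) *m B.
exists (\sum_k u ord0 k *: e`_k) => i.
have /rowP/(_ (enum_rank i)) : u *m A = \row_i c (enum_val i) by rewrite -mulmxA BA mulmx1.
rewrite !mxE enum_rankK => <-; rewrite linear_sum; apply: eq_bigr => k _.
by rewrite linearZ !mxE enum_rankK.
Qed.

Lemma chamber_nonempty : exists v, chamber D v.
Proof. by have [v hv] := alpha_surj (fun=> 1); exists v => i; rewrite hv. Qed.

Lemma chamber_coef_ge0 (n : I -> R) :
  (forall v, chamber D v -> 0 < \sum_j n j * alpha j v) -> forall j, 0 <= n j.
Proof.
move=> n0 j; rewrite leNgt; apply/negP => nj.
pose S := \sum_(k | k != j) n k.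
(* At the vector with [alpha_j = N] and all other [alpha_k = 1], the sum equals
   [n_j - |S| + S <= n_j < 0]. *)
pose N := 1 + `|S| / - n j.
have N0 : 0 < N by rewrite /N ltr_wpDr // divr_ge0 // oppr_ge0 ltW.
have [v hv] := alpha_surj (fun k => if k == j then N else 1).
have : chamber D v by move=> k; rewrite hv; case: eqP.
move=> /n0; rewrite (bigD1 j) //= hv eqxx.
under eq_bigr => k /negPf kj do rewrite hv kj mulr1.
have -> : n j * N = n j - `|S| by rewrite /N; field; rewrite lt_eqF.
by have := ler_norm S; rewrite -/S; lra.
Qed.

Lemma alpha_sum_inj (n m : I -> R) :
  (forall v, \sum_j n j * alpha j v = \sum_j m j * alpha j v) -> n =1 m.
Proof.
move=> nm j; have [v hv] := alpha_surj (fun k => (k == j)%:R).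
have ev (c : I -> R) : \sum_k c k * alpha k v = c j.
  rewrite (bigD1 j) //= hv eqxx mulr1 big1 ?addr0 // => k /negPf kj.
  by rewrite hv kj mulr0.
by rewrite -!ev.
Qed.

Lemma alpha_inj i j : (forall v, alpha i v = alpha j v) -> i = j.
Proof.
move=> ij; have [v hv] := alpha_surj (fun k => (k == j)%:R).
have := ij v; rewrite !hv eqxx; case: eqP => // _ /eqP.
by rewrite eq_sym oner_eq0.
Qed.

(* [pos w i]: the root w(alpha_i) is positive. *)
Definition pos w i := forall v, chamber D v -> 0 < (alpha i (w^-1%g v) : R).

Lemma pos_srefl w i : pos w i -> pos (w * srefl i)%g i -> False.
Proof.
move=> p1 p2; have [v cv] := chamber_nonempty.
have := p1 v cv; have := p2 v cv.
by rewrite invgM sreflV wM alpha_srefl cartan_diag; lra.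
Qed.

(* Among the factorizations w = v u with additive lengths and u an alternating
   word in s, t ending in t, one with u longest has v(alpha_s), v(alpha_t) > 0. *)
Lemma pos_or_longest_rec n w (s t : I) : s != t -> ell w = n ->
  (ell (w * srefl t)%g < ell w)%N ->
  (forall u i, (ell u < n)%N -> (ell u <= ell (u * srefl i)%g)%N -> pos u i) ->
  pos w s \/ (0 < cox s t)%N /\
    exists2 u : W, w = (u * altp s t (cox s t))%g & ell w = (ell u + cox s t)%N.
Proof.
move=> st wn wt IH.
pose P k := `[< exists2 v : W, w = (v * altp s t k)%g & ell w = (ell v + k)%N >].
have P1 : P 1%N.
  apply/asboolP; exists (w * srefl t)%g.
    by rewrite /= wordp_cons wordp_nil mulg1 mulg_sreflK.
  by have := ell_mulr_ge w t; lia.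
have Pn k : P k -> (k <= n)%N by move=> /asboolP[v _]; lia.
case: (ex_maxnP (ex_intro _ 1%N P1) Pn) => k /asboolP[v wv ev] kmax.
have k1 := kmax _ P1.
have vd i : i = s \/ i = t -> (ell v <= ell (v * srefl i)%g)%N.
  move=> ist; rewrite leqNgt; apply/negP => vi.
  have evi : ell v = (ell (v * srefl i)%g).+1 by have := ell_mulr_ge v i; lia.
  (* A descent i of v is either the letter that prolongs the alternating word, against the
     maximality of k, or its first letter, which then cancels and makes w shorter than its
     length. *)
  have [ik|ik] : i = (if odd k then s else t) \/ i = (if odd k.-1 then s else t).
  - by case: k k1 {kmax wv ev} => // k _ /=; case: odd; case: ist; auto.
  - have : P k.+1; last by move=> /kmax; rewrite ltnn.
    apply/asboolP; exists (v * srefl i)%g; last by rewrite ev evi addSnnS.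
    by rewrite altwS wordp_cons -ik -mulgA (mulgA (srefl i)) srefl_sq mul1g.
  - have wv' : w = (v * srefl i * altp s t k.-1)%g.
      rewrite wv; case: k k1 ik {kmax wv ev} => // k _ /= ik.
      by rewrite -/(altw s t k.+1) altwS wordp_cons -ik mulgA.
    have := ell_mul_wordp (v * srefl i)%g (altw s t k.-1).
    by rewrite -wv' size_altw; lia.
have vn : (ell v < n)%N by lia.
have vs : pos v s by apply: IH => //; apply: vd; left.
have vt : pos v t by apply: IH => //; apply: vd; right.
have [kc|kc] := boolP ((cox s t == 0%N) || (k < cox s t)%N).
  left=> x cx; rewrite wv invgM wM alt_coefE.
  have [a0 b0 ab] := alt_coef_ge0 st kc.
  have := vs x cx; have := vt x cx.
  set a := alpha s _; set b := alpha t _ => b1 a1.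
  have [a2|a2] := eqVneq (alt_coef s t k).1 0.
    by move: ab; rewrite a2 mul0r !add0r => ab; rewrite mulr_gt0.
  by rewrite ltr_pwDl ?mulr_ge0 ?(ltW b1) // mulr_gt0 // lt_neqAle eq_sym a2.
(* Here k is at least [cox s t]: the last [cox s t] letters split off, and the subadditivity of
   lengths forces equality for this shorter suffix. *)
right; move: kc; rewrite negb_or -lt0n -leqNgt => /andP[c0 kc]; split=> //.
have [u uk e] := altp_split s t (k - cox s t) (cox s t).
have wu : w = (v * u * altp s t (cox s t))%g.
  by rewrite -mulgA -e subnK.
exists (v * u)%g => //.
have := ell_mul v u; have := ell_mul_wordp (v * u)%g (altw s t (cox s t)).
by rewrite -wu size_altw; lia.
Qed.

(** If positivity failed, then for a descent t of w the element w would end in the full braid word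
    of i and t. By [altp_cox] that word can also be made to end in i, so i would be a descent as
    well. *)
Theorem ell_le_pos w i : (ell w <= ell (w * srefl i)%g)%N -> pos w i.
Proof.
have [n] := ubnP (ell w); elim: n => // n IH in w i *; rewrite ltnS => wn wi.
have [->|w1] := eqVneq w 1%g.
  by move=> v cv; rewrite invg1 w1; exact: cv.
have [t wt] := exists_descent w1.
have [e|it] := eqVneq i t; first by move: wt wi; rewrite e; lia.
have IHw u j : (ell u < ell w)%N -> (ell u <= ell (u * srefl j)%g)%N -> pos u j.
  by move=> uw; apply: IH; lia.
have [//|[c0 [u wu eu]]] := pos_or_longest_rec it erefl wt IHw.
move: wi; rewrite {2}wu altp_cox //; case: (cox i t) c0 eu wu => // m _ eu wu.
rewrite /= wordp_rcons mulgA mulg_sreflK.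
have := ell_mul_wordp u (altw i t m); rewrite size_altw => h1 h2.
by have := leq_trans h2 h1; rewrite eu leq_add2l ltnn.
Qed.

Lemma pos_or_longest w (s t : I) : s != t ->
  (ell (w * srefl t)%g < ell w)%N ->
  pos w s \/ (0 < cox s t)%N /\
    exists2 u : W, w = (u * altp s t (cox s t))%g & ell w = (ell u + cox s t)%N.
Proof.
by move=> st wt; apply: pos_or_longest_rec => // u i _; exact: ell_le_pos.
Qed.

Lemma ell_lt_neg w i : (ell (w * srefl i)%g < ell w)%N ->
  forall v, chamber D v -> (alpha i (w^-1%g v) : R) < 0.
Proof.
move=> wi v cv; have := @ell_le_pos (w * srefl i)%g i.
rewrite mulg_sreflK => /(_ (ltnW wi) v cv).
by rewrite invgM sreflV wM alpha_srefl cartan_diag; lra.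
Qed.

Lemma pos_ell_lt w i : pos w i -> (ell w < ell (w * srefl i)%g)%N.
Proof.
move=> p; rewrite ltnNge; apply/negP => le; apply: (pos_srefl p).
by apply: ell_le_pos; rewrite mulg_sreflK.
Qed.

Lemma ell_neq w i : ell (w * srefl i)%g <> ell w.
Proof.
move=> e; have /pos_ell_lt : pos w i by apply: ell_le_pos; rewrite e.
by rewrite e ltnn.
Qed.

Lemma all_pos_eq1 w : (forall i, pos w i) -> w = 1%g.
Proof.
move=> p; apply/eqP; apply/negPn/negP => /exists_descent[t].
by have := pos_ell_lt (p t); lia.
Qed.

Lemma ell_inv w : ell (w^-1)%g = ell w.
Proof.
have h u : (ell (u^-1)%g <= ell u)%N.
  have [s ss us] := ell_word u.
  have -> : u^-1%g = wordp (rev s).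
    rewrite us; elim: s {ss us} => [|i s IH]; first by rewrite wordp_nil invg1.
    by rewrite wordp_cons rev_cons wordp_rcons -IH invgM sreflV.
  by rewrite -ss -(size_rev s) ell_wordp.
by apply/eqP; rewrite eqn_leq h -{1}(invgK w) h.
Qed.

Lemma ell_neql w i : ell (srefl i * w)%g <> ell w.
Proof.
by rewrite -ell_inv invgM sreflV -(ell_inv w); exact: ell_neq.
Qed.

(** Words with equal last letters reduce to shorter ones. If the last letters i and j differ, both
    are descents of w, which therefore ends in the braid word of i and j. Each given word shares its
    last letter with a reduced word ending in one of the two forms of the braid word, and [braid]
    joins these two forms. *)
Theorem matsumoto (X : Type) (f : I -> X -> X) :
  (forall s t : I, s != t -> (0 < cox s t)%N -> forall x,
    foldr f x (altw s t (cox s t)) = foldr f x (altw t s (cox s t))) ->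
  forall p q : seq I, wordp p = wordp q ->
    size p = ell (wordp p) -> size q = ell (wordp q) ->
  forall x, foldr f x p = foldr f x q.
Proof.
move=> braid p; have [n] := ubnP (size p); elim: n => // n IH in p *.
case/lastP: p => [|p i] pn q pq sp sq x.
  suff -> : q = [::] by [].
  by apply: size0nil; rewrite sq -pq wordp_nil ell1.
case/lastP: q pq sq => [|q j] pq sq.
  by move: sp; rewrite pq wordp_nil ell1 size_rcons.
have same r r' k : (size r < n)%N -> wordp (rcons r k) = wordp (rcons r' k) ->
    size (rcons r k) = ell (wordp (rcons r k)) ->
    size (rcons r' k) = ell (wordp (rcons r' k)) ->
    foldr f x (rcons r k) = foldr f x (rcons r' k).
  move=> rn e er er'; rewrite !foldr_rcons; apply: IH => //.
  - by move: e; rewrite !wordp_rcons => /mulIg.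
  - exact: reduced_rcons er.
  - exact: reduced_rcons er'.
have [e|ij] := eqVneq i j.
  by rewrite -e in pq sq *; apply: same => //; rewrite size_rcons in pn.
have sz : size p = size q.
  by move: sp; rewrite pq -sq !size_rcons => -[].
set w := wordp (rcons p i) in pq sp *.
have desc r k : w = wordp (rcons r k) -> size (rcons r k) = ell (wordp (rcons r k)) ->
    (ell (w * srefl k)%g < ell w)%N.
  move=> -> <-; rewrite wordp_rcons mulg_sreflK size_rcons ltnS; exact: ell_wordp.
have wi := desc _ _ erefl sp.
have wj := desc _ _ pq sq.
have [wp|[c0 [u wu eu]]] := pos_or_longest ij wj.
  by have := pos_ell_lt wp; lia.
have [z zs zu] := ell_word u.
have ew : w = wordp (z ++ altw i j (cox i j)) by rewrite wordp_cat -zu -wu.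
have ew' : w = wordp (z ++ altw j i (cox i j)) by rewrite wordp_cat -zu -altp_cox // -wu.
have e1 (a b : I) : exists m, altw a b (cox i j) = rcons (altw b a m) b.
  by case: (cox i j) c0 => // m _; exists m.
have sza (a b : I) : size (z ++ altw a b (cox i j)) = ell w.
  by rewrite size_cat size_altw zs -eu.
have [a ea] := e1 j i; have [b eb] := e1 i j.
have pn' : (size p < n)%N by rewrite size_rcons in pn.
transitivity (foldr f x (z ++ altw j i (cox i j))).
  have := sza j i; move: ew'; rewrite ea -rcons_cat => ew' es.
  by apply: same => //; rewrite -?ew'.
rewrite foldr_cat -braid // -foldr_cat.
have := sza i j; move: ew; rewrite eb -rcons_cat => ew es.
apply/esym; apply: same; rewrite -?sz -?pq -?ew //.
by rewrite pq.
Qed.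

Lemma root_int w i : exists n : I -> int,
  forall v, alpha i (w^-1%g v) = \sum_j (n j)%:~R * alpha j v :> R.
Proof.
have [s _ ->] := ell_word w; elim/last_ind: s i => [|s k IH] i.
  exists (fun j => (j == i)%:R) => v; rewrite wordp_nil invg1 w1 (bigD1 i) //= eqxx mul1r.
  by rewrite big1 ?addr0 // => j /negPf ->; rewrite mul0r.
have [ni hi] := IH i; have [nk hk] := IH k.
have /intrP[c ec] := cartan_int k i.
exists (fun j => ni j - c * nk j) => v.
rewrite wordp_rcons invgM sreflV wM alpha_srefl hi hk ec mulr_suml -sumrB.
by apply: eq_bigr => j _; rewrite rmorphB rmorphM /=; ring.
Qed.

End Positivity.

(** * Embedding the group algebra into a field *)

Section IntegralGroupAlgebra.

Lemma lead_coefD_gt0 (F : realDomainType) (p q : {poly F}) :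
  0 < lead_coef p -> 0 < lead_coef q -> 0 < lead_coef (p + q).
Proof.
case: (ltngtP (size p) (size q)) => pq p0 q0.
- by rewrite addrC lead_coefDl.
- by rewrite lead_coefDl.
have c0 : 0 < (p + q)`_(size q).-1.
  by rewrite coefD -{1}pq addr_gt0.
suff e : size (p + q) = size q by rewrite lead_coefE e.
apply/eqP; rewrite eqn_leq (leq_trans (size_polyD p q)) ?pq ?maxnn //=.
case: (size q) c0 => // n c0; rewrite ltnNge; apply/negP => /leq_sizeP/(_ n)/=.
by move=> h; rewrite h // ltxx in c0.
Qed.

Variables (A : comNzRingType) (G : zmodType) (F : realDomainType).
Variable phi : G -> {poly F}.
Hypothesis phiD : {morph phi : x y / x + y}.
Hypothesis phi_inj : injective phi.
Hypothesis A_integral : forall a b : A, a * b = 0 -> a = 0 \/ b = 0.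

(* A translation-invariant total order on G: x is positive when the leading
   coefficient of phi x is. *)
Let P (x : G) := 0 < lead_coef (phi x).

Let phi0 : phi 0 = 0.
Proof. by apply: (@addrI _ (phi 0)); rewrite -phiD !addr0. Qed.

Let phiN x : phi (- x) = - phi x.
Proof. by apply: (@addrI _ (phi x)); rewrite -phiD !subrr. Qed.

Let P_add x y : P x -> P y -> P (x + y).
Proof. by rewrite /P phiD; exact: lead_coefD_gt0. Qed.

Let P_total x : x != 0 -> P x \/ P (- x).
Proof.
move=> x0; rewrite /P phiN lead_coefN oppr_gt0.
have : lead_coef (phi x) != 0.
  by rewrite lead_coef_eq0; apply: contra x0 => /eqP e; apply/eqP/phi_inj; rewrite phi0.
by rewrite neq_lt => /orP[]; [right|left].
Qed.

Let P0 : ~ P 0.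
Proof. by rewrite /P phi0 lead_coef0 ltxx. Qed.

Let max_exists (s : seq G) : s != [::] ->
  exists2 m, m \in s & forall x, x \in s -> x != m -> P (m - x).
Proof.
elim: s => // a s IH _; have [->|/IH[m ms mx]] := eqVneq s [::].
  by exists a; rewrite ?mem_seq1 // => x; rewrite mem_seq1 => ->.
have [em|] := eqVneq a m.
  exists m; rewrite ?inE ?ms ?orbT // => x; rewrite inE em => /orP[/eqP-> /eqP //|].
  exact: mx.
rewrite eq_sym -subr_eq0 => /P_total[ma|am].
  exists m; rewrite ?inE ?ms ?orbT // => x; rewrite inE => /orP[/eqP-> //|].
  exact: mx.
exists a; rewrite ?mem_head // => x; rewrite inE => /orP[/eqP-> /eqP //|xs] _.
have [->|xm] := eqVneq x m; first by rewrite -opprB.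
by rewrite -(subrKA m) addrC; apply: P_add; [apply: mx|rewrite -opprB].
Qed.

(** In a translation-invariant order, the largest exponents k of x and l of y are the only pair of
    exponents with sum k + l, so the coefficient there is a product of nonzero coefficients. *)
Lemma galg_integral (x y : galg A G) : x * y = 0 -> x = 0 \/ y = 0.
Proof.
move=> xy; have [->|x0] := eqVneq x 0; first by left.
have [->|y0] := eqVneq y 0; first by right.
have nz (z : galg A G) : z != 0 -> (msupp z : seq G) != [::].
  by apply: contra => /eqP sz; rewrite (galgE (fset_uniq (msupp z)) (x := z)) // sz big_nil.
have [k kx km] := max_exists (nz _ x0); have [l ly lm] := max_exists (nz _ y0).
have : mcoeff (k + l) (x * y) = mcoeff k x * mcoeff l y.
  rewrite [x * y]/GRing.mul /= /galg_mul raddf_sum (bigD1_seq k) ?fset_uniq //=.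
  rewrite [X in _ + X]big_seq_cond [X in _ + X]big1 ?addr0 => [|a /andP[ax ak]]; last first.
    rewrite raddf_sum big_seq big1 // => b bs /=; rewrite mcoeffU.
    case: eqP => // e; exfalso; apply: P0.
    have := km a ax ak; have -> : k - a = b - l.
      by apply/eqP; rewrite subr_eq eq_sym addrAC subr_eq [b + a]addrC e.
    have [->|bl] := eqVneq b l; first by rewrite subrr.
    by move=> /(P_add (lm b bs bl)); rewrite addrC subrKA subrr.
  rewrite raddf_sum (bigD1_seq l) ?fset_uniq //= mcoeffUU big1 ?addr0 // => b bl.
  by rewrite mcoeffU (inj_eq (addrI k)) (negPf bl).
rewrite xy mcoeff0 => /esym/A_integral[] e.
  by have := kx; rewrite -mcoeff_neq0 e eqxx.
by have := ly; rewrite -mcoeff_neq0 e eqxx.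
Qed.

End IntegralGroupAlgebra.

Lemma integral_field_embedding (A : comNzRingType) :
  (forall a b : A, a * b = 0 -> a = 0 \/ b = 0) ->
  exists (K : fieldType) (f : {rmorphism A -> K}), injective f.
Proof.
move=> intA.
pose unitA : {pred A} := fun x => `[< exists y, y * x = 1 >].
(* Inverses are chosen classically; a non-unit is sent to itself, as [invA_out] demands. *)
pose invA (x : A) : A :=
  if pselect (exists y, y * x = 1) is left h then projT1 (cid h) else x.
have mulVA : {in unitA, left_inverse 1 invA *%R}.
  move=> x /asboolP h; rewrite /invA; case: pselect => // h'.
  exact: (projT2 (cid h')).
have unitAP (x y : A) : y * x = 1 -> x \in unitA by move=> h; apply/asboolP; exists y.
have invA_out : {in [predC unitA], invA =1 id}.
  by move=> x /asboolP h; rewrite /invA; case: pselect.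
pose U : comUnitRingType := HB.pack_for comUnitRingType A
  (GRing.ComNzRing_hasMulInverse.Build A mulVA unitAP invA_out).
have intU : GRing.integral_domain_axiom U.
  by move=> x y /intA[] ->; rewrite eqxx ?orbT.
pose T : idomainType := HB.pack_for idomainType A U
  (GRing.ComUnitRing_isIntegral.Build U intU).
exists {fraction T}.
exists (@FracField.tofrac T : {rmorphism T -> {fraction T}}).
by move=> x y /eqP; rewrite tofrac_eq => /eqP.
Qed.

(** * The permutation of the simple roots by Omega *)

Section SimpleRootPermutation.
Variables (R : realType) (D : rootDatum R).
Local Notation V := (spaceV D).
Local Notation I := (indexI D).
Local Notation W := (weylT D).

Implicit Types (w u : W) (i j : I) (v : V).

Lemma pos_or_neg w i :
  pos w i \/ forall v, chamber D v -> (alpha i (w^-1%g v) : R) < 0.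
Proof.
case: (leqP (ell w) (ell (w * srefl i)%g)) => h.
  by left; exact: ell_le_pos.
by right; exact: ell_lt_neg.
Qed.

(* The two reflections attached to alpha_j differ by a transvection which fixes
   every simple root modulo alpha_j, hence preserves positivity. *)
Lemma coroot_uniq w i j :
  (forall v, alpha i (w^-1%g v) = alpha j v) -> w (alphav i) = alphav j.
Proof.
move=> wij; pose d := w (alphav i) - alphav j.
have jd : alpha j d = 0 :> R.
  by rewrite /d alphaB -wij wK !cartan_diag subrr.
pose u := (w * srefl i * w^-1 * srefl j)%g.
have uE v : u v = v + (alpha j v : R) *: d.
  rewrite /u !wM [srefl i _]sreflE linearB linearZ /= wKV wij.
  rewrite alpha_srefl cartan_diag sreflE /d scalerBr -addrA; congr (_ + _).
  by rewrite mulr2n mulrDr mulr1 opprD addrA subrr sub0r scaleNr opprK addrC.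
have uV v : (u^-1)%g v = v - (alpha j v : R) *: d.
  rewrite -[RHS](wK u) uE alphaB alphaZ jd mulr0 subr0 subrK //.
have u1 : u = 1%g.
  apply: all_pos_eq1 => k; have [//|neg] := pos_or_neg u k.
  have [->|kj] := eqVneq k j.
    by move=> v cv; rewrite uV alphaB alphaZ jd mulr0 subr0; exact: cv.
  (* At the chamber point with [alpha_k = N] and the other simple roots equal to 1, the supposedly
     negative root takes the value [N - alpha_k(d) >= 1]. *)
  pose N := 1 + `|alpha k d : R|.
  have [v hv] := alpha_surj (fun l => if l == k then N else 1).
  have cv : chamber D v by move=> l; rewrite hv; case: eqP => // _; rewrite /N ltr_pwDl.
  have := neg v cv; rewrite uV alphaB alphaZ !hv eqxx eq_sym (negPf kj) mul1r /N.
  by have := ler_norm (alpha k d : R); lra.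
have [v hv] := alpha_surj (fun=> 1 : R) (D := D).
have := uE v; rewrite u1 w1 hv scale1r => /eqP.
by rewrite -{1}[v]addr0 (inj_eq (addrI v)) eq_sym subr_eq0 => /eqP.
Qed.

Lemma coroot_of_simple i : coroot_of (alpha i) (alphav i).
Proof.
exists 1%g, i; rewrite w1; split=> //; apply/lfunP => v; rewrite comp_lfunE.
have -> : wval (1%g : W) = 1%g by [].
by rewrite invg1 gl1E.
Qed.

Variable E : extDatum D.

Lemma omegaM (o o' : OmegaT E) v : (o * o')%g v = o (o' v).
Proof. exact: glME. Qed.

Lemma omega1 v : (1%g : OmegaT E) v = v.
Proof. exact: gl1E. Qed.

Lemma omegaK (o : OmegaT E) v : (o^-1)%g (o v) = v.
Proof. exact: glVK. Qed.

Lemma omegaKV (o : OmegaT E) v : o ((o^-1)%g v) = v.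
Proof. exact: glKV. Qed.

Lemma omega_chamber (o : OmegaT E) v : chamber D v -> chamber D (o v).
Proof.
move=> cv; have /andP[_ /asboolP oc] := ovalP o.
by rewrite -oc; exists v.
Qed.

Lemma omega_root_int (o : OmegaT E) i : exists2 n : I -> int,
  (forall j, 0 <= n j) &
  (forall v, alpha i ((o^-1)%g v) = \sum_j (n j)%:~R * alpha j v :> R).
Proof.
have /andP[oe _] := ovalP o.
have : coroot_of (alpha i) (alphav i).
  exact: coroot_of_simple.
move=> /(eWeyl_roots oe)[w [k [/lfunP ek _]]].
have [n hn] := root_int w k.
have on v : alpha i ((o^-1)%g v) = \sum_j (n j)%:~R * alpha j v :> R.
  by rewrite -hn; have := ek v; rewrite !comp_lfunE.
exists n => // j; rewrite -(ler0z R).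
apply: (@chamber_coef_ge0 _ D (fun j => (n j)%:~R)) => v cv.
by rewrite -on; exact: omega_chamber.
Qed.

(** A height argument. Expanding along [o] and back along its inverse gives [\sum_j n_j h_j = 1],
    where the [n_j] are nonnegative integers and the heights [h_j] are at least 1; hence one [n_j]
    is 1 and all others vanish. *)
Lemma omega_root_perm (o : OmegaT E) i : exists j,
  forall v, alpha i ((o^-1)%g v) = alpha j v.
Proof.
have [n n0 hn] := omega_root_int o i.
have /choice[m hm] j : exists mj : I -> int, (forall k, 0 <= mj k) /\
    (forall v, alpha j (o v) = \sum_k (mj k)%:~R * alpha k v :> R).
  by have [mj] := omega_root_int o^-1%g j; rewrite invgK; exists mj.
pose h j := \sum_k m j k.
have h1 j : 1 <= h j.
  have [m0 mj] := hm j; rewrite -gtz0_ge1 lt_neqAle sumr_ge0 // andbT.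
  apply/eqP => /esym/eqP; rewrite psumr_eq0 // => /allP mz.
  have [v cv] := chamber_nonempty D.
  have := omega_chamber o cv j; rewrite mj big1 ?ltxx // => k _.
  by rewrite (eqP (mz k (mem_index_enum k))) mul0r.
have nh : \sum_j n j * h j = 1.
  have e k : (\sum_j n j * m j k)%:~R = (k == i)%:R :> R.
    move: k; apply: alpha_sum_inj => v.
    rewrite [RHS](bigD1 i) //= eqxx mul1r [X in _ = _ + X]big1 ?addr0; last first.
      by move=> j /negPf ->; rewrite mul0r.
    have -> : alpha i v = alpha i ((o^-1)%g (o v)) :> R by rewrite glVK.
    rewrite hn; under [RHS]eq_bigr => j _ do rewrite (hm j).2 mulr_sumr.
    rewrite exchange_big /=; apply: eq_bigr => k _.
    rewrite rmorph_sum mulr_suml; apply: eq_bigr => j _.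
    by rewrite rmorphM mulrA.
  under eq_bigr => j _ do rewrite /h mulr_sumr.
  rewrite exchange_big /= (bigD1 i) //= [X in _ + X]big1 ?addr0; last first.
    by move=> k /negPf ki; apply/eqP; rewrite -(intr_eq0 R) e ki.
  by apply/eqP; rewrite -(eqr_int R) e eqxx.
have [j nj] : exists j, n j != 0.
  apply/existsP; rewrite -negb_forall; apply/negP => /forallP nz.
  by move: nh; rewrite big1 // => j _; rewrite (eqP (nz j)) mul0r.
have nj1 : 1 <= n j by rewrite -gtz0_ge1 lt_neqAle eq_sym nj n0.
move: nh; rewrite (bigD1 j) //=.
set S := \sum_(k | k != j) _ => e.
have S0 : 0 <= S.
  by apply: sumr_ge0 => k _; rewrite mulr_ge0 // (le_trans _ (h1 k)).
have [enj eS] : n j = 1 /\ S = 0 by have := h1 j; nia.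
exists j => v; rewrite hn (bigD1 j) //= enj mul1r big1 ?addr0 // => k kj.
have : n k * h k == 0.
  move/eqP: eS; rewrite psumr_eq0 => [/allP/(_ k (mem_index_enum k))|k' _].
    by rewrite kj.
  by rewrite mulr_ge0 // (le_trans _ (h1 k')).
rewrite mulf_eq0 => /orP[/eqP->|/eqP hk]; first by rewrite mul0r.
by have := h1 k; rewrite hk.
Qed.

(** [eWeyl_roots] presents the image of the coroot as [w(alpha_k^vee)] for some w and k;
    [coroot_uniq] identifies it from the root alone. As a suitable j exists, the default value of
    [omegaI] never arises. *)
Lemma omegaIP (o : OmegaT E) i :
  (forall v, alpha (omegaI o i) v = alpha i ((o^-1)%g v)) /\ o (alphav i) = alphav (omegaI o i).
Proof.
suff [j ja jv] : exists2 j, gl_dual o (alpha i) = alpha j & o (alphav i) = alphav j.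
  rewrite /omegaI; case: pickP => [k /andP[/eqP ka /eqP kv]|/(_ j)]; last first.
    by rewrite ja jv !eqxx.
  by split=> // v /=; rewrite -ka comp_lfunE.
have [j hj] := omega_root_perm o i; exists j.
  by apply/lfunP => v; rewrite comp_lfunE hj.
have /andP[oe _] := ovalP o.
have : coroot_of (alpha i) (alphav i).
  exact: coroot_of_simple.
move=> /(eWeyl_roots oe)[w [k [/lfunP ek ->]]]; apply: coroot_uniq => v.
by rewrite -hj; have := ek v; rewrite !comp_lfunE => <-.
Qed.

Lemma omegaI_alpha (o : OmegaT E) i v :
  alpha (omegaI o i) v = alpha i ((o^-1)%g v).
Proof. exact: (omegaIP o i).1. Qed.

Lemma omegaI_alphav (o : OmegaT E) i : o (alphav i) = alphav (omegaI o i).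
Proof. exact: (omegaIP o i).2. Qed.

Lemma omegaIM (o o' : OmegaT E) i : omegaI (o * o')%g i = omegaI o (omegaI o' i).
Proof.
apply: alpha_inj => v; rewrite !omegaI_alpha invgM.
by rewrite omegaM.
Qed.

Lemma omegaI1 i : omegaI (1%g : OmegaT E) i = i.
Proof.
apply: alpha_inj => v; rewrite omegaI_alpha invg1.
by rewrite omega1.
Qed.

Lemma omega_refl (o : OmegaT E) i :
  (oval o * refl i = refl (omegaI o i) * oval o)%g.
Proof.
apply/val_inj/lfunP => v; rewrite -!/(_ v) !glME !reflE linearB linearZ /=.
by rewrite omegaI_alphav omegaI_alpha omegaK.
Qed.

(** If w preserves the chamber, its inverse has no descent. This separates the pairs (o, w) in the
    independence argument. *)
Lemma omega_weyl (o : OmegaT E) (w : W) : oval o = wval w -> o = 1%g /\ w = 1%g.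
Proof.
move=> ow; suff e : w = 1%g by split=> //; apply: val_inj; rewrite /= ow e.
suff -> : w = (w^-1)^-1%g by rewrite (@all_pos_eq1 _ _ w^-1%g) ?invg1 // => i v cv;
  rewrite invgK -ow; exact: omega_chamber.
by rewrite invgK.
Qed.

End SimpleRootPermutation.

(** * The coefficient ring and the group algebra of Y are domains *)

Section FieldEmbedding.
Variables (R : realType) (D : rootDatum R) (E : extDatum D).

Lemma Rt_integral (a b : Rt E) : a * b = 0 -> a = 0 \/ b = 0.
Proof.
(* The coordinates are packed into a polynomial so that the sign of the leading coefficient orders
   the exponents lexicographically. *)
pose phi (f : {ffun indet E -> int}) : {poly int} :=
  rVpoly (\row_(i < #|{: indet E}|) f (enum_val i)).
apply: (@galg_integral int {ffun indet E -> int} int phi).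
- by move=> f g; rewrite /phi -raddfD; congr rVpoly; apply/rowP => i; rewrite !mxE ffunE.
- move=> f g /(can_inj rVpolyK)/rowP fg; apply/ffunP => x.
  by have := fg (enum_rank x); rewrite !mxE enum_rankK.
- by move=> x y /eqP; rewrite mulf_eq0 => /orP[]/eqP; auto.
Qed.

Lemma RY_field_embedding :
  exists (K : fieldType) (f : {rmorphism RY E -> K}), injective f.
Proof.
apply: integral_field_embedding.
pose phi (y : latT E) : {poly R} := rVpoly (passmx.rVof (vbasis {:D}) (yval y)).
apply: (@galg_integral (Rt E) (latT E) R phi).
- move=> x y; rewrite /phi; have -> : yval (x + y) = yval x + yval y by [].
  have := passmx.rVof_linear (vbasis {:D}) 1 (yval x) (yval y).
  by rewrite !scale1r => ->; rewrite linearD.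
- move=> x y /(can_inj rVpolyK)/(can_inj (passmx.rVofK (vbasisP _))) xy.
  exact: val_inj.
- exact: Rt_integral.
Qed.

End FieldEmbedding.

Lemma malg_ind (T : choiceType) (A : zmodType) (P : malg T A -> Prop) : P 0 ->
  (forall x y, P x -> P y -> P (x + y)) -> (forall t a, P (mkmalgU t a)) ->
  forall x, P x.
Proof.
move=> P0 PD PU x; rewrite [x]monalgE.
by apply: big_ind => // t _; exact: PU.
Qed.

Section Evaluation.
Variables (A : comNzRingType) (S : comNzRingType) (f : {rmorphism A -> S}).

Lemma mmap_scale (T : choiceType) (h : T -> S) a (x : malg T A) :
  mmap f h (a *: x) = f a * mmap f h x.
Proof.
rewrite (mmapEw (msuppZ_le _ _)) mmapE big_distrr /=.
by apply: eq_bigr => k _; rewrite mcoeffZ rmorphM mulrA.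
Qed.

Lemma mmap_galgM (G : zmodType) (h : G -> S) :
  {morph h : k l / k + l >-> k * l} ->
  {morph (mmap f h : galg A G -> S) : x y / x * y}.
Proof.
move=> hD x y; elim/galg_ind: x => [|x x' IH IH'|k a].
- by rewrite mul0r !mmap0 mul0r.
- by rewrite mulrDl !mmapD IH IH' mulrDl.
elim/galg_ind: y => [|y y' IH IH'|l b].
- by rewrite mulr0 !mmap0 mulr0.
- by rewrite mulrDr !mmapD IH IH' mulrDr.
rewrite [_ * _ in LHS]galg_mulUU !mmapU hD. by rewrite -mulrACA; congr (_ * _); exact: rmorphM.
Qed.

End Evaluation.

(** * Demazure-Lusztig operators *)

Section ExtendedWeyl.
Variables (R : realType) (D : rootDatum R) (E : extDatum D).
Local Notation V := (spaceV D).
Local Notation W := (weylT D).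

Record eWeylT := EWeylT { eval :> GL V; evalP : eval \in eWeyl E }.
HB.instance Definition _ := [isSub for eval].
HB.instance Definition _ := [Choice of eWeylT by <:].
HB.instance Definition _ :=
  SubChoice_isSubGroup.Build (GL V) (eWeyl E) eWeylT (eWeyl_group E).

Lemma eact_subproof (g : eWeylT) (y : latT E) : g (yval y) \in latY E.
Proof.
have := eWeyl_latY (evalP g) => /seteqP[+ _]; apply; exists (yval y) => //.
exact: yvalP.
Qed.
Definition eact (g : eWeylT) (y : latT E) : latT E := LatT (eact_subproof g y).

Lemma eactD g y y' : eact g (y + y') = eact g y + eact g y'.
Proof. by apply: val_inj; rewrite /= linearD. Qed.

Lemma eactN g y : eact g (- y) = - eact g y.
Proof. by apply: val_inj; rewrite /= linearN. Qed.

Lemma eact0 g : eact g 0 = 0.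
Proof. by apply: val_inj; rewrite /= linear0. Qed.

Lemma eactM (g h : eWeylT) y : eact (g * h)%g y = eact g (eact h y).
Proof. by apply: val_inj; exact: glME. Qed.

Lemma eact1 y : eact 1%g y = y.
Proof. by apply: val_inj; exact: gl1E. Qed.

Lemma eact_inj g : injective (eact g).
Proof. by move=> x y /(congr1 (eact g^-1%g)); rewrite -!eactM mulVg !eact1. Qed.

Definition wE (w : W) : eWeylT := EWeylT (eWeyl_weyl E (wvalP w)).

Lemma wEM w u : wE (w * u)%g = (wE w * wE u)%g.
Proof. exact: val_inj. Qed.

Lemma wE1 : wE 1%g = 1%g.
Proof. exact: val_inj. Qed.

Lemma oE_subproof (o : OmegaT E) : oval o \in eWeyl E.
Proof. by have /andP[] := ovalP o. Qed.
Definition oE (o : OmegaT E) : eWeylT := EWeylT (oE_subproof o).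

Lemma oEM o o' : oE (o * o')%g = (oE o * oE o')%g.
Proof. exact: val_inj. Qed.

Lemma oE1 : oE 1%g = 1%g.
Proof. exact: val_inj. Qed.

Lemma oEV o : oE o^-1%g = (oE o)^-1%g.
Proof. by apply: (@mulgI _ (oE o)); rewrite -oEM !mulgV oE1. Qed.

Lemma oE_srefl o i : (oE o * wE (srefl i) = wE (srefl (omegaI o i)) * oE o)%g.
Proof. apply: val_inj; exact: omega_refl. Qed.

Lemma oE_wE (o : OmegaT E) w : oE o = wE w -> o = 1%g /\ w = 1%g.
Proof. by move=> /(congr1 eval) /omega_weyl. Qed.

Lemma wE_srefl_sq i : (wE (srefl i) * wE (srefl i) = 1)%g.
Proof. by rewrite -wEM srefl_sq wE1. Qed.

Lemma eact_omega o y : eact (oE o) y = omegaY o y.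
Proof. exact: val_inj. Qed.

Lemma eact_srefl i y : eact (wE (srefl i)) y = reflY i y.
Proof. exact: val_inj. Qed.

Lemma omegaY_alphav o i : omegaY o (alphavY E i) = alphavY E (omegaI o i).
Proof. by apply: val_inj; exact: omegaI_alphav. Qed.

Lemma reflY_alphav i : reflY i (alphavY E i) = - alphavY E i.
Proof.
apply: val_inj; rewrite /= reflE cartan_diag scaler_nat mulr2n opprD addrA.
by rewrite subrr sub0r.
Qed.

Lemma alphavY_neq0 i : alphavY E i != 0.
Proof.
apply/eqP => /(congr1 (fun y => alpha i (yval y) : R)) /=.
by rewrite cartan_diag linear0 => /eqP; rewrite pnatr_eq0.
Qed.

Lemma latT_double0 (y : latT E) : y + y = 0 -> y = 0.
Proof.
move=> /(congr1 (fun x => yval x)) /= h; apply: val_inj => /=.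
by apply/eqP; have /eqP := h; rewrite -mulr2n -scaler_nat scaler_eq0 pnatr_eq0.
Qed.

Lemma alpha_latT_int i (y : latT E) : exists n : int, alpha i (yval y) = n%:~R :> R.
Proof.
apply/intrP; apply: (latY_int (yvalP y)); exists 1%g, i; apply/lfunP => v.
rewrite comp_lfunE; have -> : wval (1%g : W) = 1%g by [].
by rewrite invg1 gl1E.
Qed.

Lemma yvalB (x y : latT E) : yval (x - y) = yval x - yval y.
Proof. by []. Qed.

Lemma yvalMz (y : latT E) (n : int) : yval (y *~ n) = yval y *~ n.
Proof. exact: (raddfMz (\val : latT E -> V)). Qed.

Lemma reflY_int i (y : latT E) (n : int) : alpha i (yval y) = n%:~R ->
  reflY i y = y - alphavY E i *~ n.
Proof.
move=> yn; apply: val_inj; rewrite /= reflE yn.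
rewrite ?yvalB yvalMz /=.
by rewrite scaler_int.
Qed.

Lemma indet_eq x y : param_ident E x y -> indet_of E x = indet_of E y.
Proof.
move=> xy; apply: val_inj => /=; apply/(fingraph.rootP (param_rel_sym E)).
by apply: connect1; apply/orP; left; apply/asboolP.
Qed.

(** On Y, [alpha_i] takes an odd value at y and the value 2 at the coroot, hence every integer
    value. *)
Lemma indet_ramified i (y : latT E) (n : int) :
  alpha i (yval y) = n%:~R -> odd `|n| -> indet_of E (false, i) = indet_of E (true, i).
Proof.
move=> yn on; apply: indet_eq; constructor; apply/seteqP; split.
  by move=> _ [x xY <-]; have [m /= ->] := alpha_latT_int i (LatT xY); rewrite intr_int.
move=> x /intrP[k ->]; have [c ec] : exists c : int, n = c * 2 + 1 by exists (n %/ 2)%Z; lia.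
(* With [n = 2c + 1], the value of [alpha_i] at this vector is [k(2c + 1) - 2kc = k]. *)
exists (yval (y *~ k - alphavY E i *~ (k * c))); first exact: yvalP.
rewrite ?yvalB !yvalMz /= alphaB -!scaler_int !alphaZ cartan_diag yn ec.
by rewrite rmorphD !rmorphM /=; ring.
Qed.

Lemma indet_omega (o : OmegaT E) b i : indet_of E (b, omegaI o i) = indet_of E (b, i).
Proof. by apply/esym/indet_eq; constructor. Qed.

Lemma indet_braid i j b c : alpha i (alphav j) = -1 -> alpha j (alphav i) = -1 ->
  indet_of E (b, i) = indet_of E (c, j).
Proof. by move=> *; apply: indet_eq; constructor. Qed.

Lemma indet_powV (x : indet E) : indet_pow x 1 * indet_pow x (-1) = 1.
Proof.
rewrite /indet_pow [LHS]galg_mulUU mulr1; congr mkmalgU.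
by apply/ffunP => y; rewrite !ffunE mulNrn subrr.
Qed.

Lemma ZYD (x y : latT E) : ZY (x + y) = ZY x * ZY y.
Proof. by rewrite [RHS]galg_mulUU mulr1. Qed.

Lemma ZY_inj : injective (@ZY _ _ E).
Proof.
move=> x y /(congr1 (mcoeff x)); rewrite !mcoeffU eqxx.
by case: eqP => // _ /eqP; rewrite oner_eq0.
Qed.

End ExtendedWeyl.

Lemma alg_morph_quotient (A S : comNzRingType) (B : comAlgType A) (k : A -> S)
    (f : B -> S) (p p' : A) (z d q : B) :
  {morph f : x y / x * y} -> {morph f : x y / x + y} ->
  {morph f : x y / x - y} -> f 1 = 1 -> (forall a x, f (a *: x) = k a * f x) ->
  q * (1 - z ^+ 2) = (p%:A + p' *: z) * d ->
  f q * (1 - f z ^+ 2) = (k p + k p' * f z) * f d.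
Proof.
move=> fM fD fB f1 fZ /(congr1 f).
by rewrite !fM fB fD !fZ !expr2 !fM f1 mulr1.
Qed.

Section Operators.
Variables (R : realType) (D : rootDatum R) (E : extDatum D).
Local Notation W := (weylT D).
Local Notation G := (eWeylT E).
Variables (K : fieldType) (iota : {rmorphism RY E -> K}).
Hypothesis iota_inj : injective iota.
Variable kappa : {rmorphism Rt E -> K}.
Hypothesis iotaU : forall y a, iota (mkmalgU y a) = kappa a * iota (ZY y).

Implicit Types (g : G) (y : latT E) (o : OmegaT E) (w : W) (phi : G -> K).

Lemma iotaB f h : iota (f - h) = iota f - iota h.
Proof. exact: rmorphB. Qed.

Definition mono y : K := iota (ZY y).

Lemma iota_mono y a : iota (mkmalgU y a) = kappa a * mono y.
Proof. exact: iotaU. Qed.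

Lemma monoD y y' : mono (y + y') = mono y * mono y'.
Proof. by rewrite /mono ZYD rmorphM. Qed.

Lemma mono0 : mono 0 = 1.
Proof. exact: rmorph1. Qed.

Lemma mono_neq0 y : mono y != 0.
Proof.
apply/eqP => y0; have := mono0; rewrite -(subrr y) monoD y0 mul0r => /eqP.
by rewrite eq_sym oner_eq0.
Qed.

Lemma monoN y : mono (- y) = (mono y)^-1.
Proof.
apply: (mulfI (mono_neq0 y)); rewrite -monoD subrr mono0 divff //.
exact: mono_neq0.
Qed.

Lemma mono_inj : injective mono.
Proof. by move=> x y /iota_inj/ZY_inj. Qed.

Definition sE i : G := wE E (srefl i).

(** The variable z of b, translated by g. Values of functions at g are recorded after applying g to
    the coefficients, so [bcoef i g] is the g-translate of b. *)
Definition zroot i g := mono (- eact g (alphavY E i)).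
Definition ksigma i := kappa (sigma E i).
Definition ksigmaV i := kappa (sigmaV E i).
Definition kdiff i := kappa (sigma E i - sigmaV E i).
Definition kdiff' i := kappa (sigma' E i - sigmaV' E i).
Definition bcoef i g := (kdiff i + kdiff' i * zroot i g) / (1 - zroot i g ^+ 2).

(* Right multiplication by r_i on the functions G -> K stands for r_i in the
   twisted group algebra, so that K itself needs no action of the group. *)
Definition Hop i phi g := bcoef i g * phi g + (ksigma i - bcoef i g) * phi (g * sE i)%g.
Definition Zop y phi g := mono (eact g y) * phi g.
Definition Top o phi g := phi (g * oE o)%g.

Lemma kdiffE i : kdiff i = ksigma i - ksigmaV i.
Proof. exact: rmorphB. Qed.

Lemma ksigmaVr i : ksigma i * ksigmaV i = 1.
Proof. by rewrite -rmorphM indet_powV rmorph1. Qed.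

Lemma zroot_neq0 i g : zroot i g != 0. Proof. exact: mono_neq0. Qed.

Lemma zroot_sq_neq1 i g : 1 - zroot i g ^+ 2 != 0.
Proof.
rewrite subr_eq0 eq_sym; apply/eqP; rewrite /zroot expr2 -monoD -mono0.
move=> /mono_inj; rewrite -opprD => /eqP; rewrite oppr_eq0 => /eqP/latT_double0.
by rewrite -(eact0 g) => /eact_inj/eqP; rewrite (negPf (alphavY_neq0 E i)).
Qed.

Lemma sEK i g : (g * sE i * sE i)%g = g.
Proof. by rewrite -mulgA wE_srefl_sq mulg1. Qed.

Lemma zroot_sE i g : zroot i (g * sE i)%g = (zroot i g)^-1.
Proof. by rewrite /zroot eactM eact_srefl reflY_alphav -monoN eactN. Qed.

(** The identity [b(z) + b(1/z) = sigma_i - sigma_i^-1], from which the quadratic relation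
    follows. *)
Lemma bcoef_sE i g : bcoef i (g * sE i)%g = kdiff i - bcoef i g.
Proof.
rewrite /bcoef zroot_sE; have := zroot_neq0 i g; have := zroot_sq_neq1 i g.
move: (zroot i g) (kdiff i) (kdiff' i) => z p p' z1 z0.
have z2 : z ^+ 2 - 1 != 0 by rewrite -opprB oppr_eq0.
by field; rewrite z0 z1 z2.
Qed.

Lemma Hop_quad i phi : Hop i (Hop i phi) = fun g => kdiff i * Hop i phi g + phi g.
Proof.
apply: funext => g; rewrite /Hop sEK bcoef_sE kdiffE.
move: (ksigmaVr i) (phi g) (phi _); move: (ksigma i) (ksigmaV i) (bcoef i g) => t t' b e x y.
by ring: e.
Qed.

(** Multiplied by [1 - z^2], the coefficient becomes [sigma_i^-1 - (sigma_i' - sigma_i'^-1) z -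
    sigma_i z^2]. Its constant term is a unit, because neither the exponent of z nor its double is
    0. *)
Lemma Hop_coef_neq0 i g : ksigma i - bcoef i g != 0.
Proof.
apply/eqP => h.
have : ksigmaV i - kdiff' i * zroot i g - ksigma i * zroot i g ^+ 2 = 0.
  have -> : ksigmaV i - kdiff' i * zroot i g - ksigma i * zroot i g ^+ 2 =
     (ksigma i - bcoef i g) * (1 - zroot i g ^+ 2).
    rewrite mulrBl divfK ?zroot_sq_neq1 // kdiffE.
    by move: (ksigma i) (ksigmaV i) (kdiff' i) (zroot i g) => *; ring.
  by rewrite h mul0r.
pose x := - eact g (alphavY E i).
have x0 : x != 0.
  by rewrite oppr_eq0 -(eact0 g) (inj_eq (@eact_inj _ _ _ g)) alphavY_neq0.
have xx0 : x + x != 0 by apply: contra x0 => /eqP/latT_double0 ->.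
rewrite /zroot -/x expr2 -monoD.
have -> : ksigmaV i - kdiff' i * mono x - ksigma i * mono (x + x) =
  iota ((mkmalgU 0 (sigmaV E i) : RY E) - (mkmalgU x (sigma' E i - sigmaV' E i) : RY E)
        - (mkmalgU (x + x) (sigma E i) : RY E)).
  by rewrite iotaB iotaB !iota_mono mono0 mulr1.
rewrite -(rmorph0 iota) => /iota_inj/(congr1 (mcoeff 0)).
rewrite !mcoeffB !mcoeffU eqxx (negPf x0) (negPf xx0) !subr0 mcoeff0.
rewrite mulr1n => s0; have := indet_powV (indet_of E (false, i)).
by rewrite -/(sigmaV E i) s0 mulr0 => /eqP; rewrite eq_sym oner_eq0.
Qed.

Lemma TopM o o' phi : Top o (Top o' phi) = Top (o * o')%g phi.
Proof. by apply: funext => g; rewrite /Top oEM mulgA. Qed.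

Lemma Top1 phi : Top 1%g phi = phi.
Proof. by apply: funext => g; rewrite /Top oE1 mulg1. Qed.

Lemma ZopD y y' phi : Zop y (Zop y' phi) = Zop (y + y') phi.
Proof. by apply: funext => g; rewrite /Zop eactD monoD mulrA. Qed.

Lemma Zop0 phi : Zop 0 phi = phi.
Proof. by apply: funext => g; rewrite /Zop eact0 mono0 mul1r. Qed.

Lemma Top_Zop o y phi : Top o (Zop y phi) = Zop (omegaY o y) (Top o phi).
Proof. by apply: funext => g; rewrite /Top /Zop eactM eact_omega. Qed.

Lemma zroot_omega o i g : zroot i (g * oE o)%g = zroot (omegaI o i) g.
Proof. by rewrite /zroot eactM eact_omega omegaY_alphav. Qed.

Lemma bcoef_omega o i g : bcoef i (g * oE o)%g = bcoef (omegaI o i) g.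
Proof.
by rewrite /bcoef zroot_omega /kdiff /kdiff' /sigma /sigmaV /sigma' /sigmaV' !indet_omega.
Qed.

Lemma Top_Hop o i phi : Top o (Hop i phi) = Hop (omegaI o i) (Top o phi).
Proof.
apply: funext => g; rewrite /Top /Hop bcoef_omega -!mulgA oE_srefl.
by rewrite /ksigma /sigma indet_omega.
Qed.

Definition ev g : RY E -> K := mmap kappa (fun y => mono (eact g y)).

Lemma evM g : {morph ev g : x y / x * y}.
Proof. by apply: mmap_galgM => y y'; rewrite eactD monoD. Qed.

Lemma evZY g y : ev g (ZY y) = mono (eact g y).
Proof.
transitivity (kappa 1 * mono (eact g y)); first exact: mmapU.
by rewrite (rmorph1 kappa) mul1r.
Qed.

Lemma evU g y a : ev g (mkmalgU y a) = kappa a * mono (eact g y).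
Proof. exact: mmapU. Qed.

Lemma evD g p q : ev g (p + q) = ev g p + ev g q.
Proof. exact: mmapD. Qed.

Lemma evB g p q : ev g (p - q) = ev g p - ev g q.
Proof. exact: mmapB. Qed.

Lemma ev1 g : ev g 1 = 1.
Proof. by rewrite (evZY g 0) eact0 mono0. Qed.

Lemma evZ g a x : ev g (a *: x) = kappa a * ev g x.
Proof. exact: mmap_scale. Qed.

Lemma is_b_mul_ev i y q g : is_b_mul i (ZY y - ZY (reflY i y)) q ->
  ev g q = bcoef i g * (mono (eact g y) - mono (eact g (reflY i y))).
Proof.
move/(alg_morph_quotient (evM g) (evD g) (evB g) (ev1 g) (evZ g)).
rewrite evB !evZY eactN => e; apply: (mulIf (zroot_sq_neq1 i g)).
rewrite {}e /bcoef.
by rewrite mulrAC divfK ?zroot_sq_neq1.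
Qed.

Lemma Hop_Zop i y q phi : is_b_mul i (ZY y - ZY (reflY i y)) q ->
  Hop i (Zop y phi) = fun g => Zop (reflY i y) (Hop i phi) g + ev g q * phi g.
Proof.
move=> hq; apply: funext => g; rewrite /Hop /Zop (is_b_mul_ev g hq) eactM eact_srefl.
move: (bcoef i g) (ksigma i) (mono _) (mono _) (phi g) (phi _) => *; ring.
Qed.

End Operators.

(** * Braid relations *)

Section BraidOnCycle.
Variables (K : fieldType).

(* A Demazure-Lusztig operator along a path v_0, v_1, ...: it pairs v_k with
   v_k.+1 for the k of parity par, and e k is its coefficient b at v_k, the
   coefficient at the other end of the edge being p - e k. *)
Definition hop (par : bool) (t p : K) (e f : nat -> K) (k : nat) : K :=
  if odd k == par then e k * f k + (t - e k) * f k.+1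
  else (p - e k.-1) * f k + (t - (p - e k.-1)) * f k.-1.

Variables (X : Type) (v : nat -> X) (Hs Ht : (X -> K) -> X -> K).
Variables (e : nat -> K) (t p s q : K).
(** Positions are kept positive so that [k.-1] is a true predecessor. A braid word of length m
    evaluated at position m applies operators at positions 1 to 2m - 1 only, and reaches 0 and 2m
    only through the values of [phi]. *)
Hypothesis HsE : forall psi k,
  Hs psi (v k.+1) = hop false t p e (fun j => psi (v j)) k.+1.
Hypothesis HtE : forall psi k,
  Ht psi (v k.+1) = hop true s q e (fun j => psi (v j)) k.+1.

Lemma braid_A1A1 phi : v 4%N = v 0%N -> e 2%N = p - e 0%N -> e 3%N = q - e 1%N ->
  Hs (Ht phi) (v 2%N) = Ht (Hs phi) (v 2%N).
Proof.
move=> v4 e2 e3; rewrite !(HsE, HtE) /hop /= !(HsE, HtE) /hop /= v4 e2 e3.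
move: (e 0%N) (e 1%N) (phi (v 0%N)) (phi (v 1%N)) (phi (v 2%N)) (phi (v 3%N)) => *; ring.
Qed.

(** Here and in the next types, the exponents of x and y in the first half of the [e k] run through
    the positive coroots of the rank-two system in their order along the cycle. *)
Lemma braid_A2 phi x y : t = s -> p = q -> v 6%N = v 0%N ->
  1 - x != 0 -> 1 - x * y != 0 -> 1 - y != 0 ->
  e 0%N = p / (1 - x) -> e 1%N = p / (1 - x * y) -> e 2%N = p / (1 - y) ->
  e 3%N = p - e 0%N -> e 4%N = p - e 1%N -> e 5%N = p - e 2%N ->
  Hs (Ht (Hs phi)) (v 3%N) = Ht (Hs (Ht phi)) (v 3%N).
Proof.
move=> ts pq v6 h0 h1 h2 e0 e1 e2 e3 e4 e5.
do 3 rewrite !(HsE, HtE) /hop /=.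
rewrite v6 e3 e4 e5 e0 e1 e2 -ts -pq.
move: (phi (v 0%N)) (phi (v 1%N)) (phi (v 2%N)) (phi (v 3%N)) (phi (v 4%N)) (phi (v 5%N)).
by move=> *; field; rewrite h0 h1 h2.
Qed.

(** The s-edges carry the simplified quotient [p / (1 - z)], while the t-edges keep a second
    parameter [q']: an entry -1 forces [sigma_s = sigma_s'], but the entry -2 forces nothing on
    t. *)
Lemma braid_B2 phi x y q' : v 8%N = v 0%N ->
  1 - x != 0 -> 1 - (x * y) ^+ 2 != 0 -> 1 - x * y ^+ 2 != 0 -> 1 - y ^+ 2 != 0 ->
  e 0%N = p / (1 - x) -> e 1%N = (q + q' * (x * y)) / (1 - (x * y) ^+ 2) ->
  e 2%N = p / (1 - x * y ^+ 2) -> e 3%N = (q + q' * y) / (1 - y ^+ 2) ->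
  e 4%N = p - e 0%N -> e 5%N = q - e 1%N -> e 6%N = p - e 2%N -> e 7%N = q - e 3%N ->
  Hs (Ht (Hs (Ht phi))) (v 4%N) = Ht (Hs (Ht (Hs phi))) (v 4%N).
Proof.
move=> v8 h0 h1 h2 h3 e0 e1 e2 e3 e4 e5 e6 e7.
do 4 rewrite !(HsE, HtE) /hop /=.
rewrite v8 e4 e5 e6 e7 e0 e1 e2 e3.
move: (phi (v 0%N)) (phi (v 1%N)) (phi (v 2%N)) (phi (v 3%N)) (phi (v 4%N)) (phi (v 5%N)).
move: (phi (v 6%N)) (phi (v 7%N)).
by move=> *; field; rewrite h0 h1 h2 h3.
Qed.

Lemma braid_G2 phi x y : v 12%N = v 0%N ->
  1 - x != 0 -> 1 - x * y != 0 -> 1 - x ^+ 2 * y ^+ 3 != 0 ->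
  1 - x * y ^+ 2 != 0 -> 1 - x * y ^+ 3 != 0 -> 1 - y != 0 ->
  e 0%N = p / (1 - x) -> e 1%N = q / (1 - x * y) ->
  e 2%N = p / (1 - x ^+ 2 * y ^+ 3) -> e 3%N = q / (1 - x * y ^+ 2) ->
  e 4%N = p / (1 - x * y ^+ 3) -> e 5%N = q / (1 - y) ->
  e 6%N = p - e 0%N -> e 7%N = q - e 1%N -> e 8%N = p - e 2%N -> e 9%N = q - e 3%N ->
  e 10%N = p - e 4%N -> e 11%N = q - e 5%N ->
  Hs (Ht (Hs (Ht (Hs (Ht phi))))) (v 6%N) = Ht (Hs (Ht (Hs (Ht (Hs phi))))) (v 6%N).
Proof.
move=> v12 h0 h1 h2 h3 h4 h5 e0 e1 e2 e3 e4 e5 e6 e7 e8 e9 e10 e11.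
do 6 rewrite !(HsE, HtE) /hop /=.
rewrite v12 e6 e7 e8 e9 e10 e11 e0 e1 e2 e3 e4 e5.
move: (phi (v 0%N)) (phi (v 1%N)) (phi (v 2%N)) (phi (v 3%N)) (phi (v 4%N)) (phi (v 5%N)).
move: (phi (v 6%N)) (phi (v 7%N)) (phi (v 8%N)) (phi (v 9%N)) (phi (v 10%N)) (phi (v 11%N)).
by move=> *; field; rewrite h0 h1 h2 h3 h4 h5.
Qed.

End BraidOnCycle.

(** For even m, [1 - z^2] divides [1 - z^m]. For odd m the numerator is [p(1 + z)], and [1 - z]
    divides [1 - z^m]. *)
Lemma quotient_exists (A : comNzRingType) (B : comAlgType A) (p p' : A)
    (z u : B) (m : nat) : (odd m -> p = p') ->
  exists q, q * (1 - z ^+ 2) = (p%:A + p' *: z) * (u * (1 - z ^+ m)).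
Proof.
move=> pm; case: (boolP (odd m)) => om.
  exists (p%:A * u * \sum_(i < m) z ^+ i).
  rewrite -(opprB (z ^+ m)) subrX1 -(pm om) -[p *: z]mulr_algl; ring.
exists ((p%:A + p' *: z) * u * \sum_(i < m./2) (z ^+ 2) ^+ i).
have -> : z ^+ m = (z ^+ 2) ^+ m./2.
  by rewrite -exprM mul2n -{1}(odd_double_half m) (negPf om).
by rewrite -(opprB (_ ^+ m./2)) subrX1; ring.
Qed.

Section Braid.
Variables (R : realType) (D : rootDatum R) (E : extDatum D).
Local Notation I := (indexI D).
Local Notation G := (eWeylT E).
Variables (K : fieldType) (iota : {rmorphism RY E -> K}).
Hypothesis iota_inj : injective iota.
Variable kappa : {rmorphism Rt E -> K}.

Local Notation Hop := (Hop iota kappa).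
Local Notation bcoef := (bcoef iota kappa).
Local Notation zroot := (zroot iota).
Local Notation mono := (mono iota).
Local Notation ksigma := (ksigma kappa).
Local Notation kdiff := (kdiff kappa).
Local Notation kdiff' := (kdiff' kappa).
Local Notation sE := (sE E).

(** In contrast with [altw] the first letter is fixed, so lengthening the word multiplies on the
    right, as a step along the cycle does. *)
Fixpoint altl (s t : I) n : seq I :=
  if n is m.+1 then s :: altl t s m else [::].

Lemma altl_cat (s t : I) m n :
  altl s t (m + n) = altl s t m ++ (if odd m then altl t s n else altl s t n).
Proof.
by elim: m s t => //= m IH s t; rewrite IH; case: odd.
Qed.

Lemma altw_altl (s t : I) n : altw s t n = if odd n then altl t s n else altl s t n.
Proof. by elim: n => // n IH; rewrite altwS IH /=; case: odd. Qed.

Lemma wordp_altl (s t : I) n : wordp (altl s t n) = (wordp (altw t s n))^-1%g.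
Proof.
elim: n s t => [|n IH] s t; first by rewrite /= wordp_nil invg1.
by rewrite /= wordp_cons wordp_rcons IH invgM sreflV.
Qed.

Lemma altl_S (s t : I) n :
  wordp (altl s t n.+1) = (wordp (altl s t n) * srefl (if odd n then t else s))%g.
Proof.
rewrite -addn1 altl_cat wordp_cat; congr (_ * _)%g.
by case: odd; rewrite /= wordp_cons wordp_nil mulg1.
Qed.

(* The orbit of g under right multiplication by <r_s, r_t>, read along the
   2m-cycle whose edges are alternately of type s and t; g sits at index m. *)
Definition cyc (s t : I) m (g : G) k : G :=
  (g * (wE E (wordp (altl s t m)))^-1 * wE E (wordp (altl s t k)))%g.

Lemma cyc_mid s t m g : cyc s t m g m = g.
Proof. by rewrite /cyc -mulgA mulVg mulg1. Qed.

Lemma cyc_period s t m g : wordp (altw s t m) = wordp (altw t s m) ->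
  cyc s t m g (m + m) = cyc s t m g 0.
Proof.
move=> e; rewrite /cyc; congr (_ * wE E _)%g.
by rewrite altl_cat -altw_altl wordp_cat wordp_altl -e mulVg wordp_nil.
Qed.

Lemma cycS s t m g k :
  cyc s t m g k.+1 = (cyc s t m g k * sE (if odd k then t else s))%g.
Proof. by rewrite /cyc altl_S wEM mulgA. Qed.

Definition ecyc s t m g k := bcoef (if odd k then t else s) (cyc s t m g k).

Lemma Hop_cyc_s s t m g psi k : Hop s psi (cyc s t m g k.+1) =
  hop false (ksigma s) (kdiff s) (ecyc s t m g) (fun j => psi (cyc s t m g j)) k.+1.
Proof.
rewrite /hop /Hop /ecyc [odd k.+1]/=; case ok: (odd k) => /=.
  by rewrite (cycS _ _ _ _ k.+1) /= ok.
by rewrite (cycS _ _ _ _ k) ok sEK (bcoef_sE iota_inj).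
Qed.

Lemma Hop_cyc_t s t m g psi k : Hop t psi (cyc s t m g k.+1) =
  hop true (ksigma t) (kdiff t) (ecyc s t m g) (fun j => psi (cyc s t m g j)) k.+1.
Proof.
rewrite /hop /Hop /ecyc [odd k.+1]/=; case ok: (odd k) => /=; last first.
  by rewrite (cycS _ _ _ _ k.+1) /= ok.
by rewrite (cycS _ _ _ _ k) ok sEK (bcoef_sE iota_inj).
Qed.

Lemma plane_s (s t : I) (x y : R) :
  srefl s (x *: alphav s + y *: alphav t) =
  (- x - alpha s (alphav t) * y) *: alphav s + y *: alphav t.
Proof.
by have := srefl_plane s t 0 x y; rewrite linear0 subr0 !add0r.
Qed.

Lemma plane_t (s t : I) (x y : R) :
  srefl t (x *: alphav s + y *: alphav t) =
  x *: alphav s + (- y - alpha t (alphav s) * x) *: alphav t.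
Proof.
by have := srefl_plane' s t 0 x y; rewrite linear0 subr0 !add0r.
Qed.

Lemma monoX (y : latT E) n : mono (y *+ n) = mono y ^+ n.
Proof. by elim: n => [|n IH]; rewrite ?mono0 // mulrS monoD IH exprS. Qed.

Lemma yvalMn (y : latT E) n : yval (y *+ n) = n%:R *: yval y.
Proof. by rewrite scaler_nat; elim: n => // n IH; rewrite !mulrS -IH. Qed.

Lemma eactMn (g : G) (y : latT E) n : eact g (y *+ n) = eact g y *+ n.
Proof. by elim: n => [|n IH]; rewrite ?eact0 // !mulrS eactD IH. Qed.

Lemma zroot_cyc s t m g k (a b : nat) i (base := cyc s t m g 0) :
  wordp (altl s t k) (alphav i) = a%:R *: alphav s + b%:R *: alphav t ->
  zroot i (cyc s t m g k) = zroot s base ^+ a * zroot t base ^+ b.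
Proof.
move=> h; rewrite /zroot -!monoX -monoD; congr mono.
rewrite !mulNrn -opprD; congr (- _); rewrite /base /cyc !eactM.
rewrite -!eactMn -!eactD wordp_nil wE1 !eact1; congr (eact _ (eact _ _)).
by apply: val_inj; apply: (etrans h); congr (_ + _); apply/esym; exact: yvalMn.
Qed.

Lemma zroot_cyc_opp s t m g k i j :
  wordp (altl s t (k + m)) (alphav i) = - wordp (altl s t k) (alphav j) ->
  zroot i (cyc s t m g (k + m)) = (zroot j (cyc s t m g k))^-1.
Proof.
move=> h; rewrite /zroot -monoN; congr mono; congr (- _).
by rewrite /cyc !eactM -!eactN; congr (eact _ (eact _ _)); rewrite eactN; apply: val_inj; exact: h.
Qed.

Lemma bcoef_inv i j g g' : zroot i g = (zroot j g')^-1 -> kdiff i = kdiff j -> kdiff' i = kdiff' j ->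
  bcoef i g = kdiff j - bcoef j g'.
Proof.
rewrite /bcoef => -> -> ->; have := zroot_neq0 iota j g'; have := zroot_sq_neq1 iota_inj j g'.
move: (zroot j g') (kdiff j) (kdiff' j) => z p p' z1 z0.
have z2 : z ^+ 2 - 1 != 0 by rewrite -opprB oppr_eq0.
by field; rewrite z0 z1 z2.
Qed.

Lemma bcoef_unramified i g : kdiff' i = kdiff i -> bcoef i g = kdiff i / (1 - zroot i g).
Proof.
rewrite /bcoef => ->; have := zroot_sq_neq1 iota_inj i g.
move: (zroot i g) (kdiff i) => z p.
have -> : 1 - z ^+ 2 = (1 - z) * (1 + z) by ring.
have -> : p + p * z = p * (1 + z) by ring.
by rewrite mulf_eq0 => /norP[_ z1]; rewrite -mulf_div divff ?mulr1.
Qed.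

Lemma zroot_neq1 i g : 1 - zroot i g != 0.
Proof.
have := zroot_sq_neq1 iota_inj i g; apply: contra; rewrite subr_eq0 => /eqP <-.
by rewrite expr1n subrr.
Qed.

Lemma ramified_kdiff i (y : latT E) (n : int) : alpha i (yval y) = n%:~R ->
  odd `|n| -> kdiff' i = kdiff i.
Proof.
move=> yn on; rewrite /kdiff /kdiff' /sigma /sigmaV /sigma' /sigmaV'.
by rewrite (indet_ramified yn on).
Qed.

Lemma braid_params i j : alpha i (alphav j) = -1 -> alpha j (alphav i) = -1 ->
  ksigma i = ksigma j /\ kdiff i = kdiff j.
Proof.
move=> ij ji; rewrite /ksigma /kdiff /sigma /sigmaV.
by rewrite (indet_braid E false false ij ji).
Qed.

Local Notation braid s t m := (forall phi,
  foldr Hop phi (altw s t m) = foldr Hop phi (altw t s m)).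

Section RankTwo.
Variables (s t : I) (c d : int).
Hypothesis st : s != t.
Hypothesis sc : alpha s (alphav t) = c%:~R.
Hypothesis td : alpha t (alphav s) = d%:~R.
Local Notation type k := (if odd k then t else s).

(** An integer model of the action on the span of two coroots. It computes, so the coroots along
    each cycle below are found by [erefl]. *)
Fixpoint plane_act (b : bool) n (x : int * int) : int * int :=
  if n is m.+1 then
    let y := plane_act (~~ b) m x in
    if b then (- y.1 - c * y.2, y.2) else (y.1, - y.2 - d * y.1)
  else x.

Lemma plane_actE b n x :
  wordp (if b then altl s t n else altl t s n)
    (x.1%:~R *: alphav s + x.2%:~R *: alphav t) =
  (plane_act b n x).1%:~R *: alphav s + (plane_act b n x).2%:~R *: alphav t.
Proof.
elim: n b => [|n IH] b; first by case: b; rewrite /= wordp_nil w1.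
case: b; rewrite /= wordp_cons wM.
  by rewrite (IH false) plane_s sc -intrM -rmorphN -rmorphB.
by rewrite (IH true) plane_t td -intrM -rmorphN -rmorphB.
Qed.

(** The coroot met at position n: the image, under the prefix of length n, of the simple coroot of
    the edge from n to n + 1. *)
Definition plane_root n := plane_act true n (if odd n then (0, 1) else (1, 0)).

Lemma plane_rootE n : wordp (altl s t n) (alphav (type n)) =
  (plane_root n).1%:~R *: alphav s + (plane_root n).2%:~R *: alphav t.
Proof.
rewrite -(plane_actE true); congr (wordp _ _).
by case: odd => /=; rewrite scale0r scale1r ?addr0 ?add0r.
Qed.

Variables (m : nat) (g : G).
Hypothesis cm : cox s t = m.
Hypothesis m0 : (0 < m)%N.
Local Notation v := (cyc s t m g).
Local Notation e := (ecyc s t m g).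
Local Notation X := (zroot s (v 0)).
Local Notation Y := (zroot t (v 0)).

Lemma v_period : v (m + m) = v 0.
Proof. by apply: cyc_period; have := altp_cox st; rewrite cm; apply. Qed.

Lemma zroot_root k (a b : nat) : plane_root k = (a%:Z, b%:Z) ->
  zroot (type k) (v k) = X ^+ a * Y ^+ b.
Proof. by move=> h; apply: zroot_cyc; rewrite plane_rootE h. Qed.

(** Half a turn of the cycle negates the coroot, and [b(1/z) = p - b(z)]. For odd m it also
    exchanges the types s and t, which is why the parameters of the two types have to be
    compared. *)
Lemma e_opp k : plane_root (k + m) = (- (plane_root k).1, - (plane_root k).2) ->
  kdiff (type (k + m)) = kdiff (type k) -> kdiff' (type (k + m)) = kdiff' (type k) ->
  e (k + m) = kdiff (type k) - e k.
Proof.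
move=> h; apply: bcoef_inv; apply: zroot_cyc_opp.
by rewrite !plane_rootE h /= !rmorphN !scaleNr opprD.
Qed.

End RankTwo.

Lemma Hop_braid_A1A1 (s t : I) : s != t -> cox s t = 2%N ->
  alpha s (alphav t) = 0 -> alpha t (alphav s) = 0 -> braid s t 2.
Proof.
move=> st cm E1 E2 phi; apply: funext => g.
have opp := @e_opp s t 0 0 E1 E2 2 g.
rewrite -{1 2}(cyc_mid s t 2 g).
apply: (braid_A1A1 (Hop_cyc_s s t 2 g) (Hop_cyc_t s t 2 g)).
- exact: v_period st _ g cm isT.
- exact: (opp 0%N erefl erefl erefl).
- exact: (opp 1%N erefl erefl erefl).
Qed.

Lemma Hop_braid_A2 (s t : I) : s != t -> cox s t = 3%N ->
  alpha s (alphav t) = -1 -> alpha t (alphav s) = -1 -> braid s t 3.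
Proof.
move=> st cm E1 E2 phi; apply: funext => g.
have [ets eps] := braid_params E1 E2.
have us : kdiff' s = kdiff s by apply: (@ramified_kdiff s (alphavY E t) (-1)).
have ut : kdiff' t = kdiff t by apply: (@ramified_kdiff t (alphavY E s) (-1)).
have eu : kdiff' t = kdiff' s := etrans ut (etrans (esym eps) (esym us)).
have opp := @e_opp s t (-1) (-1) E1 E2 3 g.
have zr := @zroot_root s t (-1) (-1) E1 E2 3 g.
pose v := cyc s t 3 g; pose x := zroot s (v 0); pose y := zroot t (v 0).
have z1 : zroot t (v 1) = x * y by exact: (zr 1%N 1%N 1%N erefl).
have z2 : zroot s (v 2) = y by apply: (etrans (zr 2%N 0%N 1%N erefl)); exact: mul1r.
(* In odd length [altw s t] both begins and ends with t, so the two sides are swapped with respect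
   to [braid_A2]. *)
rewrite -{1 2}(cyc_mid s t 3 g); apply/esym.
apply: (@braid_A2 K _ v _ _ _ _ _ _ _ (Hop_cyc_s s t 3 g) (Hop_cyc_t s t 3 g) phi x y).
- exact: ets.
- exact: eps.
- exact: v_period st _ g cm isT.
- exact: zroot_neq1.
- by rewrite -z1 zroot_neq1.
- by rewrite -z2 zroot_neq1.
- exact: bcoef_unramified.
- by rewrite -z1 eps; exact: bcoef_unramified.
- by rewrite -z2; exact: bcoef_unramified.
- exact: (opp 0%N erefl (esym eps) eu).
- by rewrite eps; exact: (opp 1%N erefl eps (esym eu)).
- exact: (opp 2%N erefl (esym eps) eu).
Qed.

Lemma Hop_braid_B2 (s t : I) : s != t -> cox s t = 4%N ->
  alpha s (alphav t) = -1 -> alpha t (alphav s) = -2 -> braid s t 4.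
Proof.
move=> st cm E1 E2 phi; apply: funext => g.
have us : kdiff' s = kdiff s by apply: (@ramified_kdiff s (alphavY E t) (-1)).
have opp := @e_opp s t (-1) (-2) E1 E2 4 g.
have zr := @zroot_root s t (-1) (-2) E1 E2 4 g.
pose v := cyc s t 4 g; pose x := zroot s (v 0); pose y := zroot t (v 0).
have z1 : zroot t (v 1) = x * y by exact: (zr 1%N 1%N 1%N erefl).
have z2 : zroot s (v 2) = x * y ^+ 2 by exact: (zr 2%N 1%N 2%N erefl).
have z3 : zroot t (v 3) = y by apply: (etrans (zr 3%N 0%N 1%N erefl)); exact: mul1r.
rewrite -{1 2}(cyc_mid s t 4 g).
apply: (@braid_B2 K _ v _ _ _ _ _ _ _ (Hop_cyc_s s t 4 g) (Hop_cyc_t s t 4 g) phi x y (kdiff' t)).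
- exact: v_period st _ g cm isT.
- exact: zroot_neq1.
- by rewrite -z1 (zroot_sq_neq1 iota_inj).
- by rewrite -z2 zroot_neq1.
- by rewrite -z3 (zroot_sq_neq1 iota_inj).
- exact: bcoef_unramified.
- by rewrite -z1.
- by rewrite -z2; exact: bcoef_unramified.
- by rewrite -z3.
- exact: (opp 0%N erefl erefl erefl).
- exact: (opp 1%N erefl erefl erefl).
- exact: (opp 2%N erefl erefl erefl).
- exact: (opp 3%N erefl erefl erefl).
Qed.

Lemma Hop_braid_G2 (s t : I) : s != t -> cox s t = 6%N ->
  alpha s (alphav t) = -1 -> alpha t (alphav s) = -3 -> braid s t 6.
Proof.
move=> st cm E1 E2 phi; apply: funext => g.
have us : kdiff' s = kdiff s by apply: (@ramified_kdiff s (alphavY E t) (-1)).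
have ut : kdiff' t = kdiff t by apply: (@ramified_kdiff t (alphavY E s) (-3)).
have opp := @e_opp s t (-1) (-3) E1 E2 6 g.
have zr := @zroot_root s t (-1) (-3) E1 E2 6 g.
pose v := cyc s t 6 g; pose x := zroot s (v 0); pose y := zroot t (v 0).
have z1 : zroot t (v 1) = x * y by exact: (zr 1%N 1%N 1%N erefl).
have z2 : zroot s (v 2) = x ^+ 2 * y ^+ 3 by exact: (zr 2%N 2%N 3%N erefl).
have z3 : zroot t (v 3) = x * y ^+ 2 by exact: (zr 3%N 1%N 2%N erefl).
have z4 : zroot s (v 4) = x * y ^+ 3 by exact: (zr 4%N 1%N 3%N erefl).
have z5 : zroot t (v 5) = y by apply: (etrans (zr 5%N 0%N 1%N erefl)); exact: mul1r.
rewrite -{1 2}(cyc_mid s t 6 g).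
apply: (@braid_G2 K _ v _ _ _ _ _ _ _ (Hop_cyc_s s t 6 g) (Hop_cyc_t s t 6 g) phi x y).
- exact: v_period st _ g cm isT.
- exact: zroot_neq1.
- by rewrite -z1 zroot_neq1.
- by rewrite -z2 zroot_neq1.
- by rewrite -z3 zroot_neq1.
- by rewrite -z4 zroot_neq1.
- by rewrite -z5 zroot_neq1.
- exact: bcoef_unramified.
- by rewrite -z1; exact: bcoef_unramified.
- by rewrite -z2; exact: bcoef_unramified.
- by rewrite -z3; exact: bcoef_unramified.
- by rewrite -z4; exact: bcoef_unramified.
- by rewrite -z5; exact: bcoef_unramified.
- exact: (opp 0%N erefl erefl erefl).
- exact: (opp 1%N erefl erefl erefl).
- exact: (opp 2%N erefl erefl erefl).
- exact: (opp 3%N erefl erefl erefl).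
- exact: (opp 4%N erefl erefl erefl).
- exact: (opp 5%N erefl erefl erefl).
Qed.

Theorem Hop_braid (s t : I) : s != t -> (0 < cox s t)%N -> braid s t (cox s t).
Proof.
move=> st; have ts : t != s by rewrite eq_sym.
have := coxP st.
move E1 : (alpha s (alphav t) : R) => a; move E2 : (alpha t (alphav s) : R) => b.
move Em : (cox s t) => m; have Em' : cox t s = m by rewrite coxC.
move=> sp; case: sp E1 E2 Em Em' => // E1 E2 Em Em' _ phi.
- exact: Hop_braid_A1A1.
- exact: Hop_braid_A2.
- exact: Hop_braid_B2.
- by apply/esym; exact: Hop_braid_B2.
- exact: Hop_braid_G2.
- by apply/esym; exact: Hop_braid_G2.
Qed.

End Braid.

(** * The faithful representation *)

Section Representation.
Variables (R : realType) (D : rootDatum R) (E : extDatum D).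
Local Notation I := (indexI D).
Local Notation W := (weylT D).
Local Notation G := (eWeylT E).
Variables (K : fieldType) (iota : {rmorphism RY E -> K}).
Hypothesis iota_inj : injective iota.
Variable kappa : {rmorphism Rt E -> K}.
Hypothesis iotaU : forall y a, iota (mkmalgU y a) = kappa a * iota (ZY y).

Local Notation Hop := (Hop iota kappa).
Local Notation Zop := (Zop iota).
Local Notation ev := (ev iota kappa).
Local Notation mono := (mono iota).
Local Notation kdiff := (kdiff kappa).
Local Notation T := (OmegaT E * latT E * W)%type.

Implicit Types (phi psi : G -> K) (g : G) (w u : W) (x z : BLH E).

Definition rword w : seq I := s2val (cid2 (ell_word w)).

Lemma size_rword w : size (rword w) = ell w.
Proof. exact: s2valP (cid2 (ell_word w)). Qed.

Lemma wordp_rword w : wordp (rword w) = w.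
Proof. by apply/esym; exact: s2valP' (cid2 (ell_word w)). Qed.

Definition Hwop w phi := foldr Hop phi (rword w).

Lemma Hwop_word (p : seq I) phi : size p = ell (wordp p) ->
  Hwop (wordp p) phi = foldr Hop phi p.
Proof.
move=> sp; apply: matsumoto => //; last 2 first.
- exact: wordp_rword.
- by rewrite size_rword wordp_rword.
by move=> s t st c psi; exact: Hop_braid.
Qed.

Lemma Hwop1 phi : Hwop 1%g phi = phi.
Proof. by rewrite -wordp_nil Hwop_word //= wordp_nil ell1. Qed.

Lemma Hwop_gt i w phi : (ell w < ell (srefl i * w)%g)%N ->
  Hwop (srefl i * w)%g phi = Hop i (Hwop w phi).
Proof.
move=> lw; have e : (srefl i * w)%g = wordp (i :: rword w).
  by rewrite wordp_cons wordp_rword.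
rewrite e Hwop_word // -e /= size_rword.
by have := ell_wordp (i :: rword w); rewrite -e /= size_rword; lia.
Qed.

Lemma Hwop_lt i w phi : (ell (srefl i * w)%g < ell w)%N ->
  Hop i (Hwop w phi) = fun g => kdiff i * Hwop w phi g + Hwop (srefl i * w)%g phi g.
Proof.
move=> lw; have e : w = (srefl i * (srefl i * w))%g.
  by rewrite mulgA srefl_sq mul1g.
have ew : Hwop w phi = Hop i (Hwop (srefl i * w)%g phi).
  by rewrite {1}e; apply: Hwop_gt; rewrite -e.
by rewrite ew (Hop_quad iota_inj).
Qed.

Lemma Hwop_srefl i phi : Hwop (srefl i) phi = Hop i phi.
Proof.
rewrite -[srefl i]mulg1 Hwop_gt ?Hwop1 // ell1 lt0n; apply/eqP => e.
by apply: (@ell_neql _ _ (1%g : W) i); rewrite e ell1.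
Qed.

Definition lin (L : (G -> K) -> G -> K) := forall c phi psi,
  L (fun g => c * phi g + psi g) = fun g => c * L phi g + L psi g.

Lemma lin0 L : lin L -> L (fun=> 0) = fun=> 0.
Proof.
move=> Ll; have := Ll 1 (fun=> 0) (fun=> 0).
have -> : (fun g : G => 1 * 0 + 0 : K) = fun=> 0 by apply: funext => g; rewrite mul1r addr0.
move=> e; apply: funext => g; have := congr1 (fun f => f g) e.
by rewrite /= mul1r => /eqP; rewrite -{1}[L _ g]addr0 (inj_eq (addrI _)) eq_sym => /eqP.
Qed.

Lemma linD L phi psi : lin L ->
  L (fun g => phi g + psi g) = fun g => L phi g + L psi g.
Proof.
move=> Ll; have := Ll 1 phi psi.
have -> : (fun g => 1 * phi g + psi g) = fun g => phi g + psi g.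
  by apply: funext => g; rewrite mul1r.
by move=> ->; apply: funext => g; rewrite mul1r.
Qed.

Lemma linZ L c phi : lin L -> L (fun g => c * phi g) = fun g => c * L phi g.
Proof.
move=> Ll; have := Ll c phi (fun=> 0).
have -> : (fun g => c * phi g + 0) = fun g => c * phi g.
  by apply: funext => g; rewrite addr0.
by move=> ->; rewrite lin0 //; apply: funext => g; rewrite addr0.
Qed.

Lemma lin_comp L L' : lin L -> lin L' -> lin (L \o L').
Proof. by move=> Ll Ll' c phi psi /=; rewrite Ll' Ll. Qed.

Lemma lin_Top o : lin (Top o). Proof. by []. Qed.

Lemma lin_Zop y : lin (Zop y).
Proof. by move=> c phi psi; apply: funext => g; rewrite /Zop; move: (mono _) (phi g) (psi g) => *; ring. Qed.

Lemma lin_Hop i : lin (Hop i).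
Proof.
move=> c phi psi; apply: funext => g; rewrite /Hop.
move: (phi g) (psi g) (phi _) (psi _) => *.
move: (bcoef _ _ _ _) (ksigma _ _) => *; ring.
Qed.

Lemma lin_Hwop w : lin (Hwop w).
Proof.
rewrite /Hwop; elim: (rword w) => [|i p IH] c phi psi //=.
by rewrite IH lin_Hop.
Qed.

Definition bop (t : T) phi := Top t.1.1 (Zop t.1.2 (Hwop t.2 phi)).

Lemma lin_bop t : lin (bop t).
Proof.
exact: (lin_comp (lin_Top _) (lin_comp (lin_Zop _) (lin_Hwop _))).
Qed.

Definition Psi x phi g : K := mmap kappa (fun t => bop t phi g) x.

Lemma Psi0 phi : Psi 0 phi = fun=> 0.
Proof. by apply: funext => g; exact: mmap0. Qed.

Lemma PsiD x z phi : Psi (x + z) phi = fun g => Psi x phi g + Psi z phi g.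
Proof. by apply: funext => g; exact: mmapD. Qed.

Lemma PsiB x z phi : Psi (x - z) phi = fun g => Psi x phi g - Psi z phi g.
Proof. by apply: funext => g; exact: mmapB. Qed.

Lemma PsiZ a x phi : Psi (a *: x) phi = fun g => kappa a * Psi x phi g.
Proof. by apply: funext => g; exact: mmap_scale. Qed.

Lemma PsiU t a phi : Psi (mkmalgU t a) phi = fun g => kappa a * bop t phi g.
Proof. by apply: funext => g; exact: mmapU. Qed.

Lemma Psi_TZH o y w phi : Psi (TZH o y w) phi = bop (o, y, w) phi.
Proof.
rewrite /TZH PsiU; apply: funext => g.
by rewrite (rmorph1 kappa) mul1r.
Qed.

Lemma lin_Psi x : lin (Psi x).
Proof.
move=> c phi psi; apply: funext => g; rewrite /Psi /mmap mulr_sumr -big_split /=.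
apply: eq_bigr => t _; rewrite lin_bop.
move: (bop t phi g) (bop t psi g) (kappa _) => *; ring.
Qed.

Definition rep (M : (G -> K) -> G -> K) := exists z, forall phi, Psi z phi = M phi.

Lemma rep_bop t : rep (bop t).
Proof. by case: t => [[o y] w]; exists (TZH o y w) => phi; exact: Psi_TZH. Qed.

Lemma rep0 : rep (fun _ _ => 0).
Proof. by exists 0 => phi; exact: Psi0. Qed.

Lemma repD M M' : rep M -> rep M' -> rep (fun phi g => M phi g + M' phi g).
Proof. by move=> [z zM] [z' zM']; exists (z + z') => phi; rewrite PsiD zM zM'. Qed.

Lemma repZ a M : rep M -> rep (fun phi g => kappa a * M phi g).
Proof. by move=> [z zM]; exists (a *: z) => phi; rewrite PsiZ zM. Qed.

Lemma rep_ext M M' : (forall phi, M phi = M' phi) -> rep M -> rep M'.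
Proof. by move=> e [z zM]; exists z => phi; rewrite zM e. Qed.

(** Closure of the image of [Psi] under composition is proved one generator at a time, with the
    generator composed on the left. *)
Definition stable (L : (G -> K) -> G -> K) := forall z, rep (fun phi => L (Psi z phi)).

Lemma stable_basis L : lin L -> (forall t, rep (fun phi => L (bop t phi))) ->
  stable L.
Proof.
move=> Ll Lb; apply: malg_ind => [|x z hx hz|t a].
- by apply: rep_ext rep0 => phi; rewrite Psi0 lin0.
- by apply: rep_ext (repD hx hz) => phi; rewrite PsiD linD.
- by apply: rep_ext (repZ a (Lb t)) => phi; rewrite PsiU linZ.
Qed.

Lemma stable_comp L L' : stable L -> stable L' -> stable (L \o L').
Proof.
move=> sL sL' z; have [z' e'] := sL' z; have [z'' e''] := sL z'.
by exists z'' => phi; rewrite e'' e'.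
Qed.

Lemma stable_Top o : stable (Top o).
Proof.
apply: stable_basis; first exact: lin_Top.
case=> [[o' y] w]; apply: rep_ext (rep_bop (o * o', y, w)%g) => phi.
by rewrite /bop /= TopM.
Qed.

Lemma omegaY_VK o (y : latT E) : omegaY o (omegaY o^-1%g y) = y.
Proof. by apply: val_inj; exact: omegaKV. Qed.

Lemma omegaI_VK (o : OmegaT E) i : omegaI o (omegaI o^-1%g i) = i.
Proof. by rewrite -omegaIM mulgV omegaI1. Qed.

Lemma Zop_Top o y phi : Zop y (Top o phi) = Top o (Zop (omegaY o^-1%g y) phi).
Proof. by rewrite Top_Zop omegaY_VK. Qed.

Lemma Hop_Top o i phi : Hop i (Top o phi) = Top o (Hop (omegaI o^-1%g i) phi).
Proof. by rewrite Top_Hop omegaI_VK. Qed.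

Lemma stable_Zop y : stable (Zop y).
Proof.
apply: stable_basis; first exact: lin_Zop.
case=> [[o y'] w]; apply: rep_ext (rep_bop (o, omegaY o^-1%g y + y', w)) => phi.
by rewrite /bop /= Zop_Top ZopD.
Qed.

Lemma rep_Top o M : rep M -> rep (fun phi => Top o (M phi)).
Proof.
move=> [z zM]; have [z' e] := stable_Top o z.
by exists z' => phi; rewrite e zM.
Qed.

Lemma rep_Hop_Hwop i w y : rep (fun phi => Zop y (Hop i (Hwop w phi))).
Proof.
have [lt|gt] := ltnP (ell w) (ell (srefl i * w)%g).
  apply: rep_ext (rep_bop (1%g, y, (srefl i * w)%g)) => phi.
  by rewrite /bop /= Top1 Hwop_gt.
have {}gt : (ell (srefl i * w)%g < ell w)%N.
  by rewrite ltn_neqAle gt andbT; apply/eqP; exact: ell_neql.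
apply: rep_ext (repD (repZ (sigma E i - sigmaV E i) (rep_bop (1%g, y, w)))
  (rep_bop (1%g, y, (srefl i * w)%g))) => phi.
rewrite /bop /= !Top1 Hwop_lt // linD; last exact: lin_Zop.
by rewrite linZ //; exact: lin_Zop.
Qed.

Lemma rep_ev (q : RY E) w : rep (fun phi g => ev g q * Hwop w phi g).
Proof.
elim/galg_ind: q => [|p q hp hq|y a].
- apply: rep_ext rep0 => phi; apply: funext => g.
  by rewrite (_ : ev g 0 = 0) ?mul0r //; exact: mmap0.
- apply: rep_ext (repD hp hq) => phi; apply: funext => g.
  by rewrite evD mulrDl.
apply: rep_ext (repZ a (rep_bop (1%g, y, w))) => phi; apply: funext => g.
by rewrite evU /bop /= Top1 /Zop mulrA.
Qed.

(** With [n = alpha_i(y)] and [z = Z^(-alpha_i^vee)], the difference is [Z^y (1 - z^n)], a case of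
    [quotient_exists]. *)
Lemma is_b_mul_exists i (y : latT E) :
  exists q : RY E, is_b_mul i (ZY y - ZY (reflY i y)) q.
Proof.
have [n yn] := alpha_latT_int i y.
have ram (k : nat) : `|n|%N = k -> odd k -> sigma E i - sigmaV E i = sigma' E i - sigmaV' E i.
  move=> <- on; rewrite /sigma /sigmaV /sigma' /sigmaV'.
  by rewrite (indet_ramified yn on).
have ZYX k : ZY (- alphavY E i) ^+ k = ZY (- (alphavY E i *+ k)) :> RY E.
  elim: k => [|k IH]; first by rewrite expr0 mulr0n oppr0.
  by rewrite exprS IH mulrS opprD ZYD.
case: n yn ram => k yn ram.
  have [q hq] := quotient_exists (ZY (- alphavY E i)) (ZY y) (ram k erefl).
  exists q; rewrite /is_b_mul hq; congr (_ * _).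
  have -> : reflY i y = y + - (alphavY E i *+ k) by exact: reflY_int yn.
  by rewrite mulrBr mulr1 ZYX ZYD.
(* For negative n, [Z^(r_i(y))] is factored out instead, which keeps the exponent of z a natural
   number. *)
have [q hq] := quotient_exists (ZY (- alphavY E i)) (- ZY (reflY i y)) (ram k.+1 erefl).
exists q; rewrite /is_b_mul hq; congr (_ * _).
have {2}-> : y = reflY i y + - (alphavY E i *+ k.+1).
  by rewrite (reflY_int yn) NegzE mulrNz opprK addrK.
by rewrite mulrBr mulr1 ZYX mulNr opprK ZYD addrC.
Qed.

(** [H_i] passes [T_o] by changing its index and passes [Z^y] by relation (4). What remains is
    [H_j H_w], governed by lengths, and an element of the group algebra times [H_w]. *)
Lemma stable_Hop i : stable (Hop i).
Proof.
apply: stable_basis; first exact: lin_Hop.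
case=> [[o y] w]; set j := omegaI o^-1%g i.
have [q hq] := is_b_mul_exists j y.
apply: rep_ext (rep_Top o (repD (rep_Hop_Hwop j w (reflY j y)) (rep_ev q w))) => phi.
by rewrite /bop /= Hop_Top (Hop_Zop iota_inj _ _ hq).
Qed.

Lemma stable_Psi x : stable (Psi x).
Proof.
elim/malg_ind: x => [|x z hx hz|[[o y] w] a] u.
- by apply: rep_ext rep0 => phi; rewrite Psi0.
- by apply: rep_ext (repD (hx u) (hz u)) => phi; rewrite PsiD.
have sH : stable (Hwop w).
  rewrite /Hwop; elim: (rword w) => [|i p IH]; first by move=> z; exists z.
  exact: (stable_comp (stable_Hop i) IH).
have sb := stable_comp (stable_Top o) (stable_comp (stable_Zop y) sH).
by apply: rep_ext (repZ a (sb u)) => phi; rewrite PsiU.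
Qed.

End Representation.

(** * Linear independence and the transported product *)

Section Multiplication.
Variables (R : realType) (D : rootDatum R) (E : extDatum D).
Local Notation I := (indexI D).
Local Notation W := (weylT D).
Local Notation G := (eWeylT E).
Variables (K : fieldType) (iota : {rmorphism RY E -> K}).
Hypothesis iota_inj : injective iota.
Variable kappa : {rmorphism Rt E -> K}.
Hypothesis iotaU : forall y a, iota (mkmalgU y a) = kappa a * iota (ZY y).

Local Notation Hop := (Hop iota kappa).
Local Notation Zop := (Zop iota).
Local Notation ev := (ev iota kappa).
Local Notation mono := (mono iota).
Local Notation Hwop := (Hwop iota kappa).
Local Notation bop := (bop iota kappa).
Local Notation Psi := (Psi iota kappa).
Local Notation T := (OmegaT E * latT E * W)%type.

Implicit Types (phi psi : G -> K) (g : G) (w u : W) (x z : BLH E).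

(** Each letter of p either stays in place or moves by a reflection. Skipping a letter leads to an
    element of length below [size p], where [phi] vanishes; the one surviving path moves at every
    letter and contributes a product of coefficients [sigma_i - b_i]. *)
Lemma foldr_Hop_lead (p : seq I) g : exists2 c, c != 0 & forall phi,
  (forall u, (ell u < size p)%N -> phi (g * wE E u)%g = 0) ->
  foldr Hop phi p g = c * phi (g * wE E (wordp p))%g.
Proof.
elim: p g => [|i p IH] g.
  by exists 1 => [|phi _]; rewrite ?oner_neq0 // wordp_nil wE1 mulg1 mul1r.
have [c1 _ h1] := IH g; have [c2 c20 h2] := IH (g * sE E i)%g.
exists ((ksigma kappa i - bcoef iota kappa i g) * c2).
  by rewrite mulf_neq0 // (Hop_coef_neq0 iota_inj iotaU).
move=> phi phi0; rewrite /= /Hop h1; last by move=> u uw; apply: phi0; rewrite ltnW.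
rewrite phi0; last by rewrite ltnS ell_wordp.
rewrite mulr0 mulr0 add0r h2 => [|u uw].
  by rewrite mulrA wordp_cons wEM !mulgA.
rewrite /sE -mulgA -wEM phi0 //.
have := ell_mul (srefl i) u; have := ell_wordp [:: i].
by rewrite wordp_cons wordp_nil mulg1 /=; lia.
Qed.

Lemma exists_max_nat (S : eqType) (f : S -> nat) (s : seq S) : s != [::] ->
  exists2 a, a \in s & forall b, b \in s -> (f b <= f a)%N.
Proof.
elim: s => // a s IH _; have [->|/IH[m ms mx]] := eqVneq s [::].
  by exists a; rewrite ?mem_head // => b; rewrite mem_seq1 => /eqP->.
have [am|ma] := leqP (f a) (f m).
  by exists m => [|b]; rewrite inE ?ms ?orbT // => /orP[/eqP->|/mx].
exists a => [|b]; rewrite ?mem_head // inE => /orP[/eqP->//|/mx bm].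
exact: leq_trans bm (ltnW ma).
Qed.

Lemma Psi_eq0 x : (forall phi, Psi x phi = fun=> 0) -> x = 0.
Proof.
move=> x0; apply/eqP/negPn/negP => nx.
have sx : (msupp x : seq T) != [::].
  by apply: contra nx => /eqP sx; rewrite [x]monalgE sx big_nil.
have [[[o y] w] tx tmax] := exists_max_nat (fun t : T => ell t.2) sx.
(* As w has maximal length in the support, this delta function detects only terms with the same o
   and w. Evaluating at the inverse of o cancels the translation, so these terms sum to a nonzero
   multiple of the [iota]-image of an element of the group algebra. *)
pose g := (oE o)^-1%g; pose phi (h : G) : K := (h == wE E w)%:R.
have phi_o o' u : phi (g * oE o' * wE E u)%g = ((o' == o) && (u == w))%:R.
  rewrite /phi; congr (nat_of_bool _)%:R; apply/eqP/andP => [e|[/eqP-> /eqP->]].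
    have e' : oE (o^-1 * o')%g = wE E (w * u^-1)%g.
      rewrite oEM oEV wEM -e -!mulgA -wEM mulgV wE1 mulg1 //.
    have [eo ew] := oE_wE e'; split; apply/eqP.
      by rewrite -[o']mul1g -(mulgV o) -mulgA eo mulg1.
    by apply: (@mulIg _ u^-1%g); rewrite ew mulgV.
  by rewrite mulVg mul1g.
have lead o' w' : (ell w' <= ell w)%N -> exists2 c, c != 0 &
    Hwop w' phi (g * oE o')%g = c * ((o' == o) && (w' == w))%:R.
  move=> le; have [c c0 hc] := foldr_Hop_lead (rword w') (g * oE o')%g.
  exists c; rewrite // {1}/Hwop hc => [|u uw']; last first.
    rewrite phi_o; case: (u =P w) => [uw|]; last by rewrite andbF.
    by move: uw'; rewrite size_rword uw; lia.
  by rewrite wordp_rword phi_o.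
have [c c0 hc] := lead o w (leqnn _).
have key t : t \in msupp x ->
    bop t phi g = c * (if (t.1.1 == o) && (t.2 == w) then mono t.1.2 else 0).
  case: t => [[o' y'] w'] t'x; rewrite /bop /= /Top /Zop.
  have [c' _ hc'] := lead o' w' (tmax _ t'x).
  case: ifP hc' => [/andP[/eqP-> /eqP->] _|_ ->]; last by rewrite !mulr0.
  by rewrite hc !eqxx mulr1 mulrC mulVg eact1.
pose f : RY E := \sum_(t <- msupp x) mkmalgU t.1.2
  (if (t.1.1 == o) && (t.2 == w) then mcoeff t x else 0).
have f0 : f = 0.
  apply: iota_inj; rewrite (rmorph0 iota) /f raddf_sum.
  have := congr1 (fun h => h g) (x0 phi); rewrite /Psi /mmap /=.
  rewrite big_seq (eq_bigr (fun t => c * iota (mkmalgU t.1.2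
     (if (t.1.1 == o) && (t.2 == w) then mcoeff t x else 0)))) => [|t tx']; last first.
    rewrite key //; case: ifP => _; first by rewrite iotaU mulrCA.
    by rewrite iotaU (rmorph0 kappa) mul0r !mulr0.
  rewrite -big_seq -mulr_sumr => /eqP; rewrite mulf_eq0 (negPf c0) /= => /eqP.
  by [].
have := congr1 (mcoeff y) f0; rewrite mcoeff0 /f raddf_sum /=.
rewrite (bigD1_seq (o, y, w)) ?fset_uniq //= !eqxx mcoeffUU big1 ?addr0.
  by move=> e; move: tx; rewrite -mcoeff_neq0 e eqxx.
case=> [[o' y'] w'] ne; rewrite mcoeffU /=; case: ifP => [|_]; last exact: mul0rn.
case/andP=> /eqP eo /eqP ew; case: eqP => // ey.
by move: ne; rewrite eo ew ey eqxx.
Qed.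

Lemma Psi_inj x z : (forall phi, Psi x phi = Psi z phi) -> x = z.
Proof.
move=> xz; apply/eqP; rewrite -subr_eq0; apply/eqP/Psi_eq0 => phi.
by rewrite PsiB xz; apply: funext => g; rewrite subrr.
Qed.

Lemma mul_exists x z : exists m : BLH E, forall phi, Psi m phi = Psi x (Psi z phi).
Proof. exact: (stable_Psi iota_inj). Qed.

(** Since [Psi] is injective, this is the one product carried by [Psi] to composition, and every
    identity in it can be tested on operators. *)
Definition blmul x z : BLH E := projT1 (cid (mul_exists x z)).

Lemma Psi_blmul x z phi : Psi (blmul x z) phi = Psi x (Psi z phi).
Proof. exact: (projT2 (cid (mul_exists x z))). Qed.

Lemma Psi_To o phi : Psi (To o) phi = Top o phi.
Proof. by rewrite Psi_TZH /bop /= Hwop1 // Zop0. Qed.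

Lemma Psi_Zy y phi : Psi (Zy y) phi = Zop y phi.
Proof. by rewrite Psi_TZH /bop /= Hwop1 // Top1. Qed.

Lemma Psi_Hw w phi : Psi (Hw E w) phi = Hwop w phi.
Proof. by rewrite Psi_TZH /bop /= Zop0 Top1. Qed.

Lemma Psi_TZH_ops o y w phi : Psi (TZH o y w) phi = Top o (Zop y (Hwop w phi)).
Proof. exact: Psi_TZH. Qed.

Lemma Psi_ZH y w phi : Psi (ZH y w) phi = Zop y (Hwop w phi).
Proof. by rewrite Psi_TZH_ops Top1. Qed.

Lemma Psi_Hi i phi : Psi (Hi E i) phi = Hop i phi.
Proof. by rewrite /Hi Psi_Hw Hwop_srefl. Qed.

Lemma Psi_RY (q : RY E) phi : Psi (RY_to_BLH q) phi = fun g => ev g q * phi g.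
Proof.
apply: funext => g; rewrite /RY_to_BLH /ev /mmap mulr_suml.
rewrite /Psi raddf_sum; apply: eq_bigr => y _.
have e a : Psi (a *: Zy y) phi g = kappa a * (mono (eact g y) * phi g).
  by rewrite PsiZ Psi_Zy.
by rewrite -mulrA; exact: e.
Qed.

(* The basis elements are generalized before rewriting: comparing two of them
   up to conversion is very slow. *)
Theorem blmul_BL_algebra : BL_algebra blmul.
Proof.
split.
- move=> z a u v; apply: Psi_inj => phi.
  by rewrite Psi_blmul !(PsiD, PsiZ) !Psi_blmul.
- move=> x a u v; apply: Psi_inj => phi.
  by rewrite Psi_blmul !(PsiD, PsiZ) lin_Psi !Psi_blmul.
- by move=> x y z; apply: Psi_inj => phi; rewrite !Psi_blmul.
- by move=> x; apply: Psi_inj => phi; rewrite Psi_blmul Psi_Hw Hwop1.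
- by move=> x; apply: Psi_inj => phi; rewrite Psi_blmul Psi_Hw Hwop1.
- move=> o y w; move: (Psi_To o) (Psi_ZH y w) (Psi_TZH_ops o y w).
  move: (To o) (ZH y w) (TZH o y w) => a b c ea eb ec; apply: Psi_inj => phi.
  by rewrite Psi_blmul ea eb ec.
- move=> y w; move: (Psi_Zy y) (Psi_Hw w) (Psi_ZH y w).
  move: (Zy y) (Hw E w) (ZH y w) => a b c ea eb ec; apply: Psi_inj => phi.
  by rewrite Psi_blmul ea eb ec.
- move=> i w lt; move: (Psi_Hi i) (Psi_Hw w) (Psi_Hw (srefl i * w)%g).
  move: (Hi E i) (Hw E w) (Hw E (srefl i * w)%g) => a b c ea eb ec.
  by apply: Psi_inj => phi; rewrite Psi_blmul ea eb ec Hwop_gt.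
- move=> i w lt; move: (Psi_Hi i) (Psi_Hw w) (Psi_Hw (srefl i * w)%g).
  move: (Hi E i) (Hw E w) (Hw E (srefl i * w)%g) => a b c ea eb ec.
  by apply: Psi_inj => phi; rewrite Psi_blmul ea PsiD PsiZ eb ec Hwop_lt.
- move=> y y'; move: (Psi_Zy y) (Psi_Zy y') (Psi_Zy (y + y')).
  move: (Zy y) (Zy y') (Zy (y + y')) => a b c ea eb ec.
  by apply: Psi_inj => phi; rewrite Psi_blmul ea eb ec ZopD.
- move=> y i; have [q hq] := is_b_mul_exists i y; exists q; first exact: hq.
  move: (Psi_Hi i) (Psi_Zy y) (Psi_Zy (reflY i y)) (Psi_RY q).
  move: (Hi E i) (Zy y) (Zy (reflY i y)) (RY_to_BLH q) => a b c d ea eb ec ed.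
  apply: Psi_inj => phi; rewrite PsiB !Psi_blmul !ea eb ec ed.
  rewrite (Hop_Zop iota_inj _ _ hq); apply: funext => g.
  by rewrite addrAC subrr add0r.
- move=> o o'; move: (Psi_To o) (Psi_To o') (Psi_To (o * o')%g).
  move: (To o) (To o') (To (o * o')%g) => a b c ea eb ec.
  by apply: Psi_inj => phi; rewrite Psi_blmul ea eb ec TopM.
move=> o; exists (To o^-1%g).
have Hw1 phi : Psi (Hw E 1%g) phi = phi by rewrite Psi_Hw Hwop1.
split.
- move: (Psi_To o) (Psi_To o^-1%g) Hw1.
  move: (To o) (To o^-1%g) (Hw E 1%g) => a b c ea eb ec.
  by apply: Psi_inj => phi; rewrite Psi_blmul ea eb ec TopM mulgV Top1.
- move: (Psi_To o) (Psi_To o^-1%g) Hw1.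
  move: (To o) (To o^-1%g) (Hw E 1%g) => a b c ea eb ec.
  by apply: Psi_inj => phi; rewrite Psi_blmul ea eb ec TopM mulVg Top1.
- move=> i; move: (Psi_To o) (Psi_To o^-1%g) (Psi_Hi i) (Psi_Hi (omegaI o i)).
  move: (To o) (To o^-1%g) (Hi E i) (Hi E (omegaI o i)) => a b c d ea eb ec ed.
  apply: Psi_inj => phi.
  by rewrite !Psi_blmul ea eb ec ed Top_Hop TopM mulgV Top1.
- move=> y; move: (Psi_To o) (Psi_To o^-1%g) (Psi_Zy y) (Psi_Zy (omegaY o y)).
  move: (To o) (To o^-1%g) (Zy y) (Zy (omegaY o y)) => a b c d ea eb ec ed.
  apply: Psi_inj => phi.
  by rewrite !Psi_blmul ea eb ec ed Top_Zop TopM mulgV Top1.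
Qed.

End Multiplication.

(** * Uniqueness *)

(* The multiplications satisfying the Bernstein-Lusztig relations agree: the set
   of x with m1 x = m2 x is closed under linear combinations and under m1, and
   the relations put the generators To, Zy, Hi into it. The carrier is kept
   abstract because conversion between concrete basis elements is very slow. *)
Section AbstractUniqueness.
Variables (A : nzRingType) (B : lmodType A) (O L W I : Type).
Variables (To : O -> B) (Zy : L -> B) (Hw : W -> B) (Hi : I -> B).
Variables (ZH : L -> W -> B) (TZH : O -> L -> W -> B) (one : B).
Variables (mulO : O -> O -> O) (addL : L -> L -> L).
Variables (actI : O -> I -> I) (actL : O -> L -> L) (rL : I -> L -> L).
Variables (hh : I -> W -> B) (qq : I -> L -> B).

Record presentation (m : B -> B -> B) : Prop := Presentation {
  pres_linl : forall z, linear (m^~ z);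
  pres_linr : forall x, linear (m x);
  pres_assoc : associative m;
  pres_one : left_id one m;
  pres_TZH : forall o y w, m (To o) (ZH y w) = TZH o y w;
  pres_ZH : forall y w, m (Zy y) (Hw w) = ZH y w;
  pres_HH : forall i w, m (Hi i) (Hw w) = hh i w;
  pres_ZZ : forall y y', m (Zy y) (Zy y') = Zy (addL y y');
  pres_HZ : forall i y, m (Hi i) (Zy y) = m (Zy (rL i y)) (Hi i) + qq i y;
  pres_TT : forall o o', m (To o) (To o') = To (mulO o o');
  pres_ZT : forall o y, m (Zy y) (To o) = m (To o) (Zy (actL o y));
  pres_HT : forall o i, m (Hi i) (To o) = m (To o) (Hi (actI o i));
  pres_Hw : forall S : B -> Prop, S one -> (forall i x, S x -> S (m (Hi i) x)) ->
    forall w, S (Hw w)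
}.

Hypothesis basis_ind : forall S : B -> Prop, S 0 ->
  (forall x z, S x -> S z -> S (x + z)) ->
  (forall a o y w, S (a *: TZH o y w)) -> forall x, S x.
Hypothesis qq_ind : forall S : B -> Prop, S 0 ->
  (forall x z, S x -> S z -> S (x + z)) ->
  (forall a y, S (a *: Zy y)) -> forall i y, S (qq i y).

Lemma linear_rules (V V' : lmodType A) (f : V -> V') : linear f ->
  [/\ f 0 = 0, forall x y, f (x + y) = f x + f y & forall a x, f (a *: x) = a *: f x].
Proof.
move=> fl.
have fD x y : f (x + y) = f x + f y by have := fl 1 x y; rewrite !scale1r.
have f0 : f 0 = 0 by apply: (@addrI _ (f 0)); rewrite -fD !addr0.
by split=> // a x; have := fl a x 0; rewrite f0 !addr0.
Qed.

Variables (m1 m2 : B -> B -> B).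
Hypotheses (P1 : presentation m1) (P2 : presentation m2).

Let agree x := forall z, m1 x z = m2 x z.

Let agree0 : agree 0.
Proof.
move=> z; have [e1 _ _] := linear_rules (pres_linl P1 z).
by have [e2 _ _] := linear_rules (pres_linl P2 z); rewrite e1 e2.
Qed.

Let agreeD x x' : agree x -> agree x' -> agree (x + x').
Proof.
move=> ax ax' z; have [_ e1 _] := linear_rules (pres_linl P1 z).
by have [_ e2 _] := linear_rules (pres_linl P2 z); rewrite e1 e2 ax ax'.
Qed.

Let agreeZ a x : agree x -> agree (a *: x).
Proof.
move=> ax z; have [_ _ e1] := linear_rules (pres_linl P1 z).
by have [_ _ e2] := linear_rules (pres_linl P2 z); rewrite e1 e2 ax.
Qed.

Let agreeM x x' : agree x -> agree x' -> agree (m1 x x').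
Proof.
by move=> ax ax' z; rewrite -(pres_assoc P1) ax' ax (pres_assoc P2) -ax.
Qed.

Let agree_basis x : (forall o y w, m1 x (TZH o y w) = m2 x (TZH o y w)) -> agree x.
Proof.
move=> h z; elim/basis_ind: z => [|z z' e e'|a o y w].
- have [e1 _ _] := linear_rules (pres_linr P1 x).
  by have [e2 _ _] := linear_rules (pres_linr P2 x); rewrite e1 e2.
- have [_ e1 _] := linear_rules (pres_linr P1 x).
  by have [_ e2 _] := linear_rules (pres_linr P2 x); rewrite e1 e2 e e'.
- have [_ _ e1] := linear_rules (pres_linr P1 x).
  by have [_ _ e2] := linear_rules (pres_linr P2 x); rewrite e1 e2 h.
Qed.

Let agree_To o : agree (To o).
Proof.
have e m : presentation m -> forall o' y w, m (To o) (TZH o' y w) = TZH (mulO o o') y w.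
  by move=> P o' y w; rewrite -(pres_TZH P) (pres_assoc P) (pres_TT P) (pres_TZH P).
by apply: agree_basis => o' y w; rewrite !e.
Qed.

Let agree_Zy y : agree (Zy y).
Proof.
have e m : presentation m -> forall o y' w,
    m (Zy y) (TZH o y' w) = TZH o (addL (actL o y) y') w.
  move=> P o y' w; rewrite -(pres_TZH P) (pres_assoc P) (pres_ZT P).
  rewrite -(pres_assoc P) -(pres_ZH P y') (pres_assoc P (Zy _)) (pres_ZZ P).
  by rewrite (pres_ZH P) (pres_TZH P).
by apply: agree_basis => o' y' w; rewrite !e.
Qed.

Let agree_Hi i : agree (Hi i).
Proof.
have e m : presentation m -> forall o y w, m (Hi i) (TZH o y w) =
    m (To o) (m (Zy (rL (actI o i) y)) (hh (actI o i) w) + m (qq (actI o i) y) (Hw w)).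
  move=> P o y w; rewrite -(pres_TZH P) (pres_assoc P) (pres_HT P).
  rewrite -(pres_assoc P) -(pres_ZH P y) (pres_assoc P (Hi _)) (pres_HZ P).
  have [_ -> _] := linear_rules (pres_linl P (Hw w)).
  by rewrite -(pres_assoc P (Zy _)) (pres_HH P).
(* The right-hand side of [e] still involves m, but its left factors are [To], [Zy] and a
   combination of the [Zy], where agreement is already known. *)
apply: agree_basis => o y w; rewrite !e // agree_To agree_Zy.
congr (m2 _ (_ + _)); apply: (qq_ind agree0 agreeD) => a y'.
exact/agreeZ/agree_Zy.
Qed.

Lemma presentation_unique x z : m1 x z = m2 x z.
Proof.
suff: agree x by [].
apply: (basis_ind agree0 agreeD) => {x z} a o y w; apply: agreeZ.
rewrite -(pres_TZH P1) -(pres_ZH P1); apply: agreeM; first exact: agree_To.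
apply: agreeM; first exact: agree_Zy.
apply: (pres_Hw P1 (S := agree)) => [z|i x].
  by rewrite (pres_one P1) (pres_one P2).
exact/agreeM/agree_Hi.
Qed.

End AbstractUniqueness.

Lemma rmorph_cancel (A : comNzRingType) (K : fieldType) (f : {rmorphism A -> K})
    (z q q' r : A) : injective f -> 1 - f z ^+ 2 != 0 ->
  q * (1 - z ^+ 2) = r -> q' * (1 - z ^+ 2) = r -> q = q'.
Proof.
move=> f_inj z1 e e'; apply: f_inj; apply: (mulIf z1).
have fz : f (1 - z ^+ 2) = 1 - f z ^+ 2 by rewrite rmorphB rmorphXn rmorph1.
by rewrite -fz -!rmorphM e e'.
Qed.

Section Uniqueness.
Variables (R : realType) (D : rootDatum R) (E : extDatum D).
Local Notation I := (indexI D).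
Local Notation W := (weylT D).

(** It makes the quotient in [BL_HZ] depend on i and y alone, so two multiplications satisfy
    relation (4) with the same right-hand side. *)
Lemma is_b_mul_unique i (p q q' : RY E) : is_b_mul i p q -> is_b_mul i p q' -> q = q'.
Proof.
have [K [iota iota_inj]] := RY_field_embedding E.
apply: (rmorph_cancel iota_inj).
by have := zroot_sq_neq1 iota_inj i 1%g; rewrite /zroot eact1.
Qed.

Definition b_quot i (y : latT E) : RY E := projT1 (cid (is_b_mul_exists i y)).

Lemma b_quotP i y : is_b_mul i (ZY y - ZY (reflY i y)) (b_quot i y).
Proof. exact: (projT2 (cid (is_b_mul_exists i y))). Qed.

Definition HH_value (i : I) (w : W) : BLH E :=
  if (ell w < ell (srefl i * w)%g)%N then Hw E (srefl i * w)%g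
  else (sigma E i - sigmaV E i) *: Hw E w + Hw E (srefl i * w)%g.

Lemma BL_presentation (mul : BLH E -> BLH E -> BLH E) : BL_algebra mul ->
  presentation (@To _ _ E) (@Zy _ _ E) (@Hw _ _ E) (@Hi _ _ E) (@ZH _ _ E)
    (@TZH _ _ E) (Hw E 1%g) (fun o o' => o * o')%g +%R
    (fun o => omegaI o^-1%g) (fun o => omegaY o^-1%g) (@reflY _ _ E)
    HH_value (fun i y => RY_to_BLH (b_quot i y)) mul.
Proof.
move=> H; have mA := BL_assoc H.
(* Conjugation relations become commutation relations free of [ToV]; solving for the left factor is
   what introduces the inverse of o in the presentation. *)
have conj_l o x x' : (exists ToV, mul ToV (To o) = Hw E 1%g /\
    mul (mul (To o) x) ToV = x') -> mul x' (To o) = mul (To o) x.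
  by move=> [ToV [e <-]]; rewrite -mA e (BL_unitr H).
split.
- exact: BL_linearl H.
- exact: BL_linearr H.
- exact: mA.
- exact: BL_unitl H.
- exact: BL_TZH H.
- exact: BL_ZH H.
- move=> i w; rewrite /HH_value; case: ltnP => h; first exact: BL_HH_gt.
  by apply: (BL_HH_lt H); rewrite ltn_neqAle h andbT; apply/eqP; exact: ell_neql.
- exact: BL_ZZ H.
- move=> i y; have [q hq e] := BL_HZ H y i.
  have <- : q = b_quot i y by apply: is_b_mul_unique hq (b_quotP i y).
  by rewrite -e addrC subrK.
- exact: BL_TT H.
- move=> o y; apply: conj_l; have [ToV [_ e2 _ e4]] := BL_conj H o.
  exists ToV; split; first exact: e2.
  exact: etrans (e4 _) (congr1 (@Zy _ _ E) (omegaY_VK o y)).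
- move=> o i; apply: conj_l; have [ToV [_ e2 e3 _]] := BL_conj H o.
  exists ToV; split; first exact: e2.
  exact: etrans (e3 _) (congr1 (@Hi _ _ E) (omegaI_VK o i)).
(* Tails of a reduced word are reduced, so each letter is attached by the length-increasing case of
   (2). *)
move=> S S1 SH w; have [s ss ws] := ell_word w.
elim: s w ss ws => [|i s IH] w ss ws; first by rewrite ws wordp_nil.
have wi : w = (srefl i * wordp s)%g by rewrite ws wordp_cons.
have es : size s = ell (wordp s).
  have := ell_wordp s; have := ell_mul (srefl i) (wordp s).
  have := ell_wordp [:: i]; rewrite wordp_cons wordp_nil mulg1 -wi -ss /=; lia.
rewrite wi -(BL_HH_gt H); first by apply: SH; apply: IH.
by rewrite -wi -ss -es.
Qed.

End Uniqueness.

Lemma malg_scaleU (A : nzRingType) (T : choiceType) (a b : A) (t : T) :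
  a *: mkmalgU t b = mkmalgU t (a * b).
Proof. by apply/malgP => t'; rewrite mcoeffZ !mcoeffU mulrnAr. Qed.

Theorem mainTheorem13 (R : realType) (D : rootDatum R) (E : extDatum D) :
  exists! mul : BLH E -> BLH E -> BLH E, BL_algebra mul.
Proof.
have [K [iota iota_inj]] := RY_field_embedding E.
pose kappa : {rmorphism Rt E -> K} := iota \o GRing.in_alg (RY E).
have iotaU y a : iota (mkmalgU y a) = kappa a * iota (ZY y).
  have -> : mkmalgU y a = a%:A * ZY y :> RY E.
    by rewrite mulr_algl [RHS]galg_scaleU mulr1.
  exact: (rmorphM iota).
exists (blmul iota_inj kappa); split; first exact: blmul_BL_algebra.
move=> mul H; apply: funext => x; apply: funext => z.
have P1 := BL_presentation (blmul_BL_algebra iota_inj iotaU).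
apply: (presentation_unique _ _ P1 (BL_presentation H)).
- move=> S S0 SD SZ; apply: malg_ind => // -[[o y] w] a.
  by have := SZ a o y w; rewrite /TZH malg_scaleU mulr1.
- move=> S S0 SD SZ i y; rewrite /RY_to_BLH; by apply: big_ind.
Qed.
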